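(* Let $\alpha>0$ and $(a,b)\in\mathbb{R}^2$ with $a<b$. Then, for every $f\in L^1([a,b];\mathbb{R})$, we have $$J_b^\alpha\left(S_b^\alpha f\right)(x)=S_b^\alpha\left(J_b^\alpha f\right)(x)=\int_x^b f(y)\,dy,\quad \text{for a.e. } x\in[a,b].$$
   Context: Let $E_1(x)=\int_x^\infty \frac{e^{-t}}{t}\,dt$ for $x>0$ and $\mathcal{S}(t)=e^{-t}\int_0^\infty \frac{t^{s-1}}{\Gamma(s)}\,ds$ for $t>0$, where $\Gamma$ is the Gamma function. For $\alpha>0$, $a<b$ real and $f\in L^1([a,b];\mathbb{R})$, the right-sided fractional integrals of first and second kind of order $\alpha$ of $f$ are, for a.e. $x\in[a,b]$, $$(J_b^\alpha f)(x)=\frac{1}{\alpha}\int_x^b E_1\left(\frac{t-x}{\alpha}\right)f(t)\,dt,\qquad (S_b^\alpha f)(x)=\int_x^b \mathcal{S}\left(\frac{t-x}{\alpha}\right)f(t)\,dt.$$ *)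

(* Defs.v *)
From HB Require Import structures.
From mathcomp Require Import all_boot all_order all_algebra.
From mathcomp Require Import all_classical all_reals all_analysis.
Set Implicit Arguments.
Unset Strict Implicit.
Unset Printing Implicit Defensive.
Import Order.TTheory GRing.Theory Num.Theory.
Import numFieldNormedType.Exports.
Local Open Scope classical_set_scope.
Local Open Scope ring_scope.

Definition expint1 (R : realType) (x : R) : R :=
  \int[@lebesgue_measure R]_(t in `[x, +oo[) (expR (- t) / t).

Definition Gamma_fun (R : realType) (s : R) : R :=
  \int[@lebesgue_measure R]_(u in `]0, +oo[) (u `^ (s - 1) * expR (- u)).

Definition calS (R : realType) (t : R) : R :=
  expR (- t) *
  \int[@lebesgue_measure R]_(s in `]0, +oo[) (t `^ (s - 1) / Gamma_fun s).

(* The operators act on, and return, extended-real-valued functions: their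
   values are only guaranteed to be finite almost everywhere.  With this
   choice an equation between such a value and a real number also says that
   the integral converges absolutely, which would be lost by projecting the
   integrals to [R] with [fine]. *)
Definition fracJ (R : realType) (alpha b : R) (f : R -> \bar R) (x : R) :
    \bar R :=
  ((alpha^-1)%:E * \int[@lebesgue_measure R]_(t in `[x, b])
     ((expint1 ((t - x) / alpha))%:E * f t))%E.

Definition fracS (R : realType) (alpha b : R) (f : R -> \bar R) (x : R) :
    \bar R :=
  (\int[@lebesgue_measure R]_(t in `[x, b])
     ((calS ((t - x) / alpha))%:E * f t))%E.

(* Main.v *)
Require Import Defs.
From HB Require Import structures.
From mathcomp Require Import all_boot all_order all_algebra.
From mathcomp Require Import all_classical all_reals all_analysis.
From mathcomp Require Import measurable_realfun ring lra.
Import Order.TTheory GRing.Theory Num.Theory.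
Import numFieldNormedType.Exports.
Local Open Scope classical_set_scope.
Local Open Scope ring_scope.

(** The kernels [E_1] and [S] form a Sonine pair: [E_1 * S = 1] on ]0, +oo[
(convolution on the half-line); the theorem follows by Fubini.  Both kernels
are nonnegative, so the iterated integral of [|f|] is [\int_x^b |f|], finite for
every [x]: no exceptional null set is needed.

For the Sonine identity, let [g_r] be the density of the Gamma(r)
distribution and [F_r] its distribution function, so that
[S = \int_0^oo g_r dr] and, by Euler's Beta integral, [g_r * g_s = g_(r + s)].
With the upper incomplete Gamma function [Gamma(s, .) = Gamma(s) (1 - F_s)] one
gets [Gamma(s, .) * g_r = Gamma(s) (F_r - F_(r + s))], which telescopes when
integrated in [r]:
[(Gamma(s, .) * S)(z) = Gamma(s) \int_0^s F_r(z) dr].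
As [s] tends to [0], [Gamma(s, .)] tends to [Gamma(0, .) = E_1], whereas the
right-hand side tends to [1] since [s Gamma(s)] and [F_s(z)] tend to [1]. *)

(** * Affine changes of variables and convolution *)

(** The regularization by s > 0 is forced: at s = 0 the telescoped right-hand side is an infinite
    Gamma(0) times an integral over an empty interval. Up to the Sonine identity all functions are
    nonnegative with values in [\bar R], so that Tonelli's theorem applies without integrability.
    The price is that nothing can be subtracted freely: differences are stated as sums, and the
    telescoping step has to know that \int_0^oo F_r(z) dr is finite, which follows from the Chernoff
    bound F_r(z) <= e^z 2^-r. The limit s -> 0 is taken through the sandwich x^s E_1(x) <= Gamma(s,
    x) <= E_1(x) + s for x > 0 and 0 <= s <= 1. The left inequality and Fatou's lemma give E_1 * S
    <= 1. The right one gives E_1 * S >= 1, because its error term s contributes s times 1 * S, and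
    (1 * S)(z) is again the finite integral \int_0^oo F_r(z) dr. *)

Section lebesgue_affine.
Context {R : realType}.
Implicit Types (f : R -> \bar R) (c d : R).
Local Notation mu := (@lebesgue_measure R).
Local Open Scope ereal_scope.

Lemma measurable_affine c d :
  measurable_fun [set: measurableTypeR R]
    ((fun x => c * x + d)%R : measurableTypeR R -> measurableTypeR R).
Proof.
apply: measurable_funD => //; exact: measurable_funM.
Qed.

(** By uniqueness of Lebesgue measure: [c] times the image of [mu] under the affine map gives
    half-open intervals their length, hence equals [mu]. *)
Lemma ge0_integral_affine c d f : (0 < c)%R ->
  measurable_fun setT f -> (forall x, 0 <= f x) ->
  \int[mu]_x f x = c%:E * \int[mu]_x f (c * x + d)%R.
Proof.
move=> c0 mf f0.
pose phi : measurableTypeR R -> measurableTypeR R := (fun x => c * x + d)%R.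
have mphi : measurable_fun setT phi by exact: measurable_affine.
pose m : {measure set (measurableTypeR R) -> \bar R} :=
  measure_function_pushforward__canonical__measure_function_Measure mu mphi.
transitivity (\int[mscale (NngNum (ltW c0)) m]_x f x).
  apply: eq_measure_integral => A mA _.
  apply: lebesgue_measure_unique => // _ [[a b]] _ <-.
  rewrite /= /mscale/= /pushforward/=.
  rewrite [X in _ = _ * mu X](_ : _ = `](a - d) / c, (b - d) / c]%classic)%R;
    last first.
    apply/seteqP; split => x /=; rewrite !in_itv/= /phi ltr_pdivrMr// ler_pdivlMr//;
      by rewrite ltrBlDr lerBrDr (mulrC x).
  rewrite !lebesgue_measure_itv/= !lte_fin ltr_pM2r ?invr_gt0// ltrD2r.
  case: ifP => _; rewrite ?mule0// -!EFinD -EFinM; congr EFin.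
  by field; rewrite gt_eqF.
rewrite ge0_integral_mscale//=; congr *%E.
by rewrite ge0_integral_pushforward//= preimage_setT.
Qed.

Lemma ge0_integral_shift d f :
  measurable_fun setT f -> (forall x, 0 <= f x) ->
  \int[mu]_x f (x + d)%R = \int[mu]_x f x.
Proof.
move=> mf f0; rewrite [RHS](ge0_integral_affine 1 d)// mul1e.
by apply: eq_integral => x _; rewrite mul1r.
Qed.

Lemma ge0_integral_opp f :
  measurable_fun setT f -> (forall x, 0 <= f x) ->
  \int[mu]_x f (- x)%R = \int[mu]_x f x.
Proof.
move=> mf f0.
have mphi : measurable_fun setT (-%R : measurableTypeR R -> measurableTypeR R).
  exact: oppr_measurable.
pose m : {measure set (measurableTypeR R) -> \bar R} :=
  measure_function_pushforward__canonical__measure_function_Measure mu mphi.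
transitivity (\int[m]_x f x).
  by rewrite ge0_integral_pushforward//= preimage_setT.
by apply: eq_measure_integral => A mA _; exact: lebesgue_measureN.
Qed.

End lebesgue_affine.

(** * Convolution of nonnegative extended-real functions on the line *)

Section convolution.
Context {R : realType}.
Implicit Types (f g h : R -> \bar R).
Local Notation mu := (@lebesgue_measure R).
Local Open Scope ereal_scope.

Definition mfge0 f := measurable_fun [set: R] f /\ forall x, 0 <= f x.

Definition convol f g z := \int[mu]_u (f u * g (z - u)%R).

(** Tonelli applied to the positive and negative parts. Signed integrands are allowed because the
    inner fractional integral of a signed function must be measurable before the outer operator acts
    on it, even where it fails to converge. *)
Lemma measurable_integral2 (h : R * R -> \bar R) : measurable_fun setT h ->
  measurable_fun [set: R] (fun x => \int[mu]_y h (x, y)).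
Proof.
move=> mh.
rewrite (_ : (fun _ => _) = (fun x => \int[mu]_y (h^\+ (x, y))) \-
                           (fun x => \int[mu]_y (h^\- (x, y)))); last first.
  by apply/funext => x; rewrite [LHS]integralE; congr (_ - _);
    apply: eq_integral => y _; rewrite ?funeposE ?funenegE.
apply: emeasurable_funB.
  apply: (measurable_fun_fubini_tonelli_F (m2 := mu) h^\+) => //.
  exact: measurable_funepos.
apply: (measurable_fun_fubini_tonelli_F (m2 := mu) h^\-) => //.
exact: measurable_funeneg.
Qed.

Lemma ge0_integralC (h : R -> R -> \bar R) :
  measurable_fun setT (fun w : R * R => h w.1 w.2) ->
  (forall x y, 0 <= h x y) ->
  \int[mu]_x \int[mu]_y h x y = \int[mu]_y \int[mu]_x h x y.
Proof.
move=> mh h0; pose H (w : R * R) := h w.1 w.2.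
by apply: (fubini_tonelli (m1 := mu) (m2 := mu) H) => // w; exact: h0.
Qed.

Lemma measurable_convol2 f g : measurable_fun setT f -> measurable_fun setT g ->
  measurable_fun [set: R * R] (fun w : R * R => f w.2 * g (w.1 - w.2)%R).
Proof.
move=> mf mg; apply: emeasurable_funM; first exact: measurableT_comp.
by apply: (measurableT_comp mg); exact: measurable_funB.
Qed.

Lemma mfge0_convol f g : mfge0 f -> mfge0 g -> mfge0 (convol f g).
Proof.
move=> [mf f0] [mg g0]; split; last first.
  by move=> x; apply: integral_ge0 => u _; exact: mule_ge0.
exact: (measurable_integral2 _ (measurable_convol2 _ _ mf mg)).
Qed.

Lemma measurable_subl g z : measurable_fun [set: R] g ->
  measurable_fun [set: R] (fun u => g (z - u)%R).
Proof. by move=> mg; apply: (measurableT_comp mg); exact: measurable_funB. Qed.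

Lemma convolC f g : mfge0 f -> mfge0 g -> convol f g = convol g f.
Proof.
move=> [mf f0] [mg g0]; apply/funext => z; rewrite /convol.
have m1 : measurable_fun [set: R] (fun u => f u * g (z - u)%R).
  by apply: emeasurable_funM => //; exact: measurable_subl.
rewrite -[LHS]ge0_integral_opp//; last by move=> u; exact: mule_ge0.
rewrite -[LHS](ge0_integral_shift (- z))//.
- by apply: eq_integral => u _; rewrite muleC; congr (_ * _); congr (_ _); ring.
- apply: emeasurable_funM; first
    by apply: (measurableT_comp mf); exact: measurable_funN.
  by apply: (measurableT_comp mg); apply: measurable_funB => //; exact: measurable_funN.
- by move=> u; exact: mule_ge0.
Qed.

Lemma convolA f g h : mfge0 f -> mfge0 g -> mfge0 h ->
  convol (convol f g) h = convol f (convol g h).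
Proof.
move=> [mf f0] [mg g0] [mh h0]; apply/funext => z; rewrite /convol.
transitivity (\int[mu]_u \int[mu]_v (f v * g (u - v)%R * h (z - u)%R)).
  apply: eq_integral => u _; rewrite ge0_integralZr//.
  - by apply: emeasurable_funM => //; exact: measurable_subl.
  - by move=> v _; exact: mule_ge0.
rewrite (ge0_integralC (fun u v => f v * g (u - v)%R * h (z - u)%R))/=; last 2 first.
- apply: emeasurable_funM; first exact: measurable_convol2.
  by apply: (measurableT_comp mh); exact: measurable_funB.
- by move=> u v; rewrite !mule_ge0.
apply: eq_integral => v _.
rewrite -ge0_integralZl//; last 2 first.
- by apply: emeasurable_funM => //; exact: measurable_subl.
- by move=> u _; exact: mule_ge0.
rewrite -[LHS](ge0_integral_shift v)//.
- apply: eq_integral => u _; rewrite muleA addrK; congr (_ * h _)%E; lra.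
- apply: emeasurable_funM; last exact: measurable_subl.
  apply: emeasurable_funM => //; apply: (measurableT_comp mg).
  exact: measurable_funB.
- by move=> u; rewrite !mule_ge0.
Qed.

Lemma convolDl f g h z : mfge0 f -> mfge0 g -> mfge0 h ->
  convol (fun x => f x + g x) h z = convol f h z + convol g h z.
Proof.
move=> [mf f0] [mg g0] [mh h0]; rewrite /convol.
rewrite -ge0_integralD//.
- by apply: eq_integral => u _; rewrite ge0_muleDl.
- by move=> u _; exact: mule_ge0.
- by apply: emeasurable_funM => //; exact: measurable_subl.
- by move=> u _; exact: mule_ge0.
- by apply: emeasurable_funM => //; exact: measurable_subl.
Qed.

Lemma convolZl c f h z : 0 <= c -> mfge0 f -> mfge0 h ->
  convol (fun x => c * f x) h z = c * convol f h z.
Proof.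
move=> c0 [mf f0] [mh h0]; rewrite /convol -ge0_integralZl//.
- by apply: eq_integral => u _; rewrite muleA.
- by apply: emeasurable_funM => //; exact: measurable_subl.
- by move=> u _; exact: mule_ge0.
Qed.

Lemma convolZr c f h z : 0 <= c -> mfge0 f -> mfge0 h ->
  convol f (fun x => c * h x) z = c * convol f h z.
Proof.
move=> c0 [mf f0] [mh h0]; rewrite /convol -ge0_integralZl//.
- by apply: eq_integral => u _; rewrite muleCA.
- by apply: emeasurable_funM => //; exact: measurable_subl.
- by move=> u _; exact: mule_ge0.
Qed.

Lemma le_convoll f g h z : mfge0 f -> mfge0 g -> mfge0 h ->
  (forall x, f x <= g x) -> convol f h z <= convol g h z.
Proof.
move=> [mf f0] [mg g0] [mh h0] fg; apply: ge0_le_integral => //.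
- by move=> u _; exact: mule_ge0.
- by apply: emeasurable_funM => //; exact: measurable_subl.
- by apply: emeasurable_funM => //; exact: measurable_subl.
- by move=> u _; exact: lee_wpmul2r.
Qed.

Lemma integral_convol f g : mfge0 f -> mfge0 g ->
  \int[mu]_z convol f g z = \int[mu]_z f z * \int[mu]_z g z.
Proof.
move=> [mf f0] [mg g0]; rewrite /convol.
rewrite (ge0_integralC (fun u v => f v * g (u - v)%R))/=; last 2 first.
- exact: measurable_convol2.
- by move=> u v; rewrite mule_ge0.
rewrite -ge0_integralZr//; last exact: integral_ge0.
apply: eq_integral => u _; rewrite ge0_integralZl//.
- congr (_ * _); rewrite -[RHS](ge0_integral_shift (- u))//.
- by apply: (measurableT_comp mg); exact: measurable_funB.
Qed.

End convolution.

(** * The Gamma function *)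

Section power_integral.
Context {R : realType}.
Local Notation mu := (@lebesgue_measure R).
Implicit Types s a x : R.

Lemma continuous_powR s x : 0 < x -> {for x, continuous (fun u : R => u `^ s)}.
Proof.
move=> x0; apply: differentiable_continuous; apply/derivable1_diffP.
by apply: derivable_powR; rewrite in_itv/= x0.
Qed.

Lemma continuous_within_powR s (A : set R) : A `<=` `]0, +oo[ ->
  {within A, continuous (fun u : R => u `^ s)}.
Proof.
move=> A0; apply: continuous_in_subspaceT => x; rewrite inE => /A0/=.
rewrite in_itv/= andbT; exact: continuous_powR.
Qed.

Lemma integral_powR_itv s a : 0 < s -> 0 < a < 1 ->
  (\int[mu]_(u in `[a, 1%R]) (u `^ (s - 1))%:E = ((1 - a `^ s) / s)%:E)%E.
Proof.
move=> s0 /andP[a0 a1].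
rewrite (@continuous_FTC2 _ _ (fun u => s^-1 * u `^ s))//.
- by rewrite powR1 -EFinB mulr1 -[X in X - _]mulr1 -mulrBr mulrC.
- apply: continuous_within_powR => x /=; rewrite !in_itv/= andbT => /andP[+ _].
  exact: lt_le_trans.
- split.
  + move=> x; rewrite in_itv/= => /andP[ax _].
    apply: derivableM => //; apply: derivable_powR.
    by rewrite in_itv/= andbT (lt_trans a0).
  + apply: cvgM; first exact: cvg_cst.
    by apply: cvg_at_right_filter; exact: continuous_powR.
  + apply: cvgM; first exact: cvg_cst.
    by apply: cvg_at_left_filter; exact: continuous_powR.
- move=> x; rewrite in_itv/= => /andP[ax _].
  have x0 : x \in `]0, +oo[ by rewrite in_itv/= andbT (lt_trans a0).
  rewrite derive1Ml//; last exact: derivable_powR.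
  by rewrite powR_derive1// mulrA mulVf ?mul1r// gt_eqF.
Qed.

Lemma bigcup_itvcc01 :
  \bigcup_n `[n.+2%:R^-1, 1 : R]%classic = `]0, 1]%classic.
Proof.
apply/seteqP; split => [x [n _]|x]; rewrite /= !in_itv/=.
  move=> /andP[nx ->]; rewrite andbT; apply: lt_le_trans nx.
  by rewrite invr_gt0.
move=> /andP[x0 x1].
near \oo => n; exists n => //=; rewrite in_itv/= x1 andbT.
rewrite invf_ple ?posrE//; near: n.
exists (Num.truncn x^-1) => // n /= tn.
rewrite ltW// (lt_le_trans (truncnS_gt _))// ler_nat.
by rewrite ltnS (leq_trans tn).
Unshelve. all: by end_near. Qed.

(** For s < 1 the integrand blows up at 0, so the fundamental theorem of calculus is used on
    [1/(n+2), 1] and monotone convergence does the rest. The shift by 2 keeps the left endpoint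
    strictly below 1. *)
Lemma integral_powR01 s : 0 < s ->
  (\int[mu]_(u in `]0%R, 1%R]) (u `^ (s - 1))%:E = s^-1%:E)%E.
Proof.
move=> s0; rewrite -bigcup_itvcc01.
have sub n : `[n.+2%:R^-1, 1 : R]%classic `<=` `]0, +oo[.
  by move=> x /=; rewrite !in_itv/= andbT => /andP[+ _]; apply: lt_le_trans;
    rewrite invr_gt0.
pose S n := `[n.+2%:R^-1, 1 : R]%classic.
have F : (\int[mu]_(u in S n) (u `^ (s - 1))%:E @[n --> \oo] -->
    \int[mu]_(u in \bigcup_n S n) (u `^ (s - 1))%:E)%E.
  apply: ge0_nondecreasing_set_cvg_integral => //.
  - apply/nondecreasing_seqP => n; apply/subsetPset => x; rewrite /S /= !in_itv/=.
    move=> /andP[nx ->]; rewrite andbT; apply: le_trans nx.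
    by rewrite lef_pV2 ?posrE// ler_nat.
  - by move=> n; exact: measurable_itv.
  - move=> n; apply/measurable_EFinP.
    apply: subspace_continuous_measurable_fun.
      exact: measurable_itv.
    exact: (@continuous_within_powR (s - 1) (S n)) (sub n).
  - by move=> n x _; rewrite lee_fin powR_ge0.
rewrite -(cvg_lim _ F)//; apply/cvg_lim => //.
under eq_cvg => n do rewrite integral_powR_itv// ?invr_gt0 ?ltr0n ?invf_lt1//= ?ltr1n//.
apply: cvg_EFin; first exact: nearW.
rewrite -[X in _ --> X]mul1r; apply: cvgMl.
rewrite -[X in _ --> X]subr0; apply: cvgB; first exact: cvg_cst.
apply: ((cvg_at_rightP _ _ _).1 (powR_cvg0 s0) (fun n => n.+2%:R^-1)).
split; first by move=> n; rewrite invr_gt0.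
by have := @cvg_harmonic R; rewrite -cvg_shiftS.
Qed.

End power_integral.

Section gamma_kernel.
Context {R : realType}.
Local Notation mu := (@lebesgue_measure R).
Implicit Types r s t u z : R.

(* Written with [ln] rather than [powR] so that joint measurability in [(s, u)]
   is immediate. *)
Definition gker s u : R := if 0 < u then expR ((s - 1) * ln u - u) else 0.

Lemma powRB1 x s : 0 < x -> x `^ (s - 1) = x `^ s / x.
Proof.
by move=> x0; rewrite powRB ?powRr1 ?(ltW x0)// (gt_eqF x0) implybT.
Qed.

Lemma gker_ge0 s u : 0 <= gker s u.
Proof. by rewrite /gker; case: ifP => // _; exact: expR_ge0. Qed.

Lemma gkerE s u : 0 < u -> gker s u = u `^ (s - 1) * expR (- u).
Proof. by move=> u0; rewrite /gker u0 /powR gt_eqF// expRD. Qed.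

Lemma gker_le0 s u : u <= 0 -> gker s u = 0.
Proof. by move=> u0; rewrite /gker ltNge u0. Qed.

Lemma measurable_gker2 : measurable_fun [set: R * R] (fun w => gker w.1 w.2).
Proof.
apply: measurable_fun_ifT => //.
  exact: measurable_fun_ltr.
apply: measurableT_comp => //; apply: measurable_funB => //.
apply: measurable_funM; first exact: measurable_funB.
by apply: measurableT_comp => //; exact: measurable_ln.
Qed.

Lemma measurable_gker s : measurable_fun [set: R] (gker s).
Proof. exact: (measurableT_comp measurable_gker2 (pair1_measurable s)). Qed.

Lemma mfge0_gker s : mfge0 (fun u => (gker s u)%:E).
Proof.
split=> [|x]; last by rewrite lee_fin gker_ge0.
by apply/measurable_EFinP; exact: measurable_gker.
Qed.

Lemma gkerM s z u : 0 < z ->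
  gker s (z * u) = z `^ (s - 1) * expR ((1 - z) * u) * gker s u.
Proof.
move=> z0; rewrite /gker pmulr_rgt0//; case: ifP => u0; last by rewrite mulr0.
rewrite lnM ?posrE// /powR gt_eqF// -!expRD; congr expR; ring.
Qed.

Lemma measurable_posexp c :
  measurable_fun [set: R] (fun u : R => if 0 < u then expR (- c * u) else 0).
Proof.
apply: measurable_fun_ifT => //; first exact: measurable_fun_ltr.
by apply: measurableT_comp => //; exact: measurable_funM.
Qed.

Lemma integral_posexp_le c : 0 < c ->
  (\int[mu]_u (if 0 < u then expR (- c * u) else 0)%:E <= c^-1%:E)%E.
Proof.
move=> c0; rewrite -[leRHS]mule1 -(integral_exponential_pdf c0).
have mpdf : measurable_fun [set: R] (exponential_pdf c).
  exact: measurable_exponential_pdf.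
have pdf0 u : 0 <= exponential_pdf c u by rewrite exponential_pdf_ge0// ltW.
rewrite -ge0_integralZl//; last 3 first.
- exact/measurable_EFinP.
- by move=> u _; rewrite lee_fin.
- by rewrite lee_fin invr_ge0 ltW.
apply: ge0_le_integral => //.
- by move=> u _; rewrite lee_fin; case: ifP => // _; exact: expR_ge0.
- by apply/measurable_EFinP; exact: measurable_posexp.
- apply/measurable_EFinP; exact: measurable_funM.
- move=> u _; rewrite lee_fin; case: ifPn => u0.
    rewrite exponential_pdfE; last exact: ltW.
    by rewrite mulrA mulVf ?mul1r // gt_eqF.
  by rewrite mulr_ge0// invr_ge0 ltW.
Qed.

(** Comparison function for the singularity of the Gamma integrand at 0; on u > 1 the comparison is
    with an exponential. *)
Definition cutpow s u : R := if 0 < u <= 1 then u `^ (s - 1) else 0.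

Lemma cutpow_ge0 s u : 0 <= cutpow s u.
Proof. by rewrite /cutpow; case: ifP => // _; exact: powR_ge0. Qed.

Lemma measurable_cutpow s : measurable_fun [set: R] (cutpow s).
Proof.
apply: measurable_fun_ifT => //.
by apply: measurable_and; [exact: measurable_fun_ltr|exact: measurable_fun_ler].
Qed.

Lemma integral_cutpow s : 0 < s -> (\int[mu]_u (cutpow s u)%:E = s^-1%:E)%E.
Proof.
move=> s0; rewrite -(integral_powR01 _ s0) [RHS]integral_mkcond.
by apply: eq_integral => u _; rewrite patchE mem_setE in_itv/= /cutpow; case: ifP.
Qed.

(** * The Gamma integral: finiteness and explicit bounds *)

Definition Gam s := (\int[mu]_u (gker s u)%:E)%E.

Lemma Gamma_funE s : Gamma_fun s = fine (Gam s).
Proof.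
rewrite /Gamma_fun /Rintegral /Gam integral_mkcond; congr fine.
apply: eq_integral => u _; rewrite patchE mem_setE in_itv/= andbT.
by case: ltP => [u0|/gker_le0 ->//]; rewrite gkerE.
Qed.

Lemma Gam_lty s : 0 < s -> (Gam s < +oo)%E.
Proof.
(* [K] is (2s)^s. It comes from ln y < y at y = u / (2s), that is s ln u < s ln(2s) + u/2, which
   leaves the factor e^(-u/2) for u > 1. *)
move=> s0; pose K := expR (s * ln (2 * s)).
have K0 : 0 <= K by exact: expR_ge0.
apply: (@le_lt_trans _ _ (\int[mu]_u ((cutpow s u)%:E +
    K%:E * (if (0 < u)%R then expR (- 2^-1 * u) else 0)%:E))%E).
  apply: ge0_le_integral => //.
  - by move=> u _; rewrite lee_fin gker_ge0.
  - by apply/measurable_EFinP; exact: measurable_gker.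
  - apply: emeasurable_funD; first by apply/measurable_EFinP; exact: measurable_cutpow.
    apply: emeasurable_funM => //.
    by apply/measurable_EFinP; exact: measurable_posexp.
  - move=> u _; rewrite -EFinM -EFinD lee_fin /cutpow.
    have [u0|u0] := ltP 0 u; last by rewrite gker_le0// mulr0 addr0.
    have [u1|u1] := leP u 1 => /=.
      rewrite gkerE// -[leLHS]addr0 lerD ?mulr_ge0 ?expR_ge0//.
      by rewrite ler_piMr ?powR_ge0// expR_le1 oppr_le0 ltW.
    rewrite add0r /gker u0 /K -expRD ler_expR.
    have s20 : 0 < 2 * s by rewrite mulr_gt0.
    have := @ln_sublinear R (u / (2 * s)); rewrite divr_gt0// => /(_ isT).
    rewrite ln_div ?posrE// ltr_pdivlMr// => h.
    have := @ln_gt0 R _ u1.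
    by nra.
rewrite ge0_integralD//; last 4 first.
- by move=> u _; rewrite lee_fin cutpow_ge0.
- by apply/measurable_EFinP; exact: measurable_cutpow.
- by move=> u _; rewrite -EFinM lee_fin mulr_ge0//; case: ifP => // _; exact: expR_ge0.
- apply: emeasurable_funM => //.
  by apply/measurable_EFinP; exact: measurable_posexp.
rewrite integral_cutpow// ge0_integralZl//; last 2 first.
- by apply/measurable_EFinP; exact: measurable_posexp.
- by move=> u _; rewrite lee_fin; case: ifP => // _; exact: expR_ge0.
apply: (@le_lt_trans _ _ (s^-1%:E + K%:E * (2^-1)^-1%:E)%E); last first.
  by rewrite -EFinM -EFinD ltry.
by rewrite leeD2l// lee_wpmul2l ?lee_fin// integral_posexp_le.
Qed.

Lemma Gam_ge0 s : (0 <= Gam s)%E.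
Proof. by apply: integral_ge0 => u _; rewrite lee_fin gker_ge0. Qed.

Lemma GamE s : 0 < s -> Gam s = (Gamma_fun s)%:E.
Proof.
by move=> s0; rewrite Gamma_funE fineK// ge0_fin_numE ?Gam_ge0// Gam_lty.
Qed.

(* Only the part of the Gamma integral over [[2t, 4t]] is kept. *)
Lemma Gamma_fun_lb s t : 0 < s -> 0 < t ->
  t `^ (s - 1) * 2 `^ s * (t * expR (- (4 * t)) / 2) <= Gamma_fun s.
Proof.
move=> s0 t0; rewrite -lee_fin -GamE//.
(* On [2t, 4t] the power u^(s-1) is read as u^s / u, with u^s >= (2t)^s and 1/u >= 1/(4t); this
   works on both sides of s = 1. The length 2t of the interval then turns [k] into the claimed
   bound. *)
pose k := t `^ (s - 1) * 2 `^ s * (expR (- (4 * t)) / 4).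
have k0 : 0 <= k by rewrite !mulr_ge0 ?powR_ge0// ?expR_ge0.
pose D := `[2 * t, 4 * t]%classic : set R.
apply: (@le_trans _ _ (\int[mu]_(u in D) k%:E)%E).
  rewrite integral_cst//; last exact: measurable_itv.
  rewrite /D /= lebesgue_measure_itv/= lte_fin ltr_pM2r// ltr_nat//=.
  by rewrite -EFinB -EFinM lee_fin /k; lra.
apply: (@le_trans _ _ (\int[mu]_(u in D) (gker s u)%:E)%E); last first.
  apply: ge0_subset_integral => //; first exact: measurable_itv.
  - by apply/measurable_EFinP; exact: measurable_gker.
  - by move=> u _; rewrite lee_fin gker_ge0.
apply: ge0_le_integral => //; first exact: measurable_itv.
- apply/measurable_EFinP; apply: measurable_funTS; exact: measurable_gker.
- move=> u; rewrite /D/= in_itv/= lee_fin => /andP[tu ut].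
  have u0 : 0 < u by rewrite (lt_le_trans _ tu)// mulr_gt0.
  rewrite /k mulrA gkerE// -!mulrA.
  rewrite [leLHS](_ : _ = (t `^ (s - 1) * 2 `^ s / 4) * expR (- (4 * t))); last by lra.
  apply: ler_pM; rewrite ?mulr_ge0 ?powR_ge0 ?expR_ge0//; last first.
    by rewrite ler_expR lerN2.
  have t4 : 0 < 4 * t by rewrite mulr_gt0.
  have ut' : (4 * t)^-1 <= u^-1 by rewrite lef_pV2.
  rewrite !powRB1//.
  apply: (@le_trans _ _ ((2 * t) `^ s * (4 * t)^-1)).
    rewrite powRM ?(ltW t0)// invfM.
    by rewrite le_eqVlt; apply/orP; left; apply/eqP; ring.
  apply: ler_pM => //; rewrite ?powR_ge0 ?invr_ge0 ?(ltW t4)//.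
  by rewrite ge0_ler_powR ?nnegrE ?(ltW s0) ?(ltW u0)// mulr_ge0// ltW.
Qed.

Lemma Gamma_fun_gt0 s : 0 < s -> 0 < Gamma_fun s.
Proof.
move=> s0; apply: lt_le_trans (Gamma_fun_lb _ _ s0 (@ltr01 R)).
by rewrite !mulr_gt0 ?powR_gt0 ?expR_gt0 ?invr_gt0.
Qed.

(** The integrand is at most u^(s-1) on ]0, 1], with integral 1/s, and at most e^(-u) beyond.
    Together with [Gamma_fun_ge] this is the limit s Gamma(s) -> 1 with an explicit rate. *)
Lemma Gamma_fun_le s : 0 < s <= 1 -> s * Gamma_fun s <= 1 + s.
Proof.
move=> /andP[s0 s1].
rewrite mulrC -ler_pdivlMr// -lee_fin -GamE//.
apply: (@le_trans _ _ (\int[mu]_u ((cutpow s u)%:E +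
    (if (0 < u)%R then expR (- 1 * u) else 0)%:E))%E).
  apply: ge0_le_integral => //.
  - by move=> u _; rewrite lee_fin gker_ge0.
  - by apply/measurable_EFinP; exact: measurable_gker.
  - apply: emeasurable_funD; first by apply/measurable_EFinP; exact: measurable_cutpow.
    by apply/measurable_EFinP; exact: measurable_posexp.
  - move=> u _; rewrite -EFinD lee_fin /cutpow mulN1r.
    have [u0|u0] := ltP 0 u; last by rewrite gker_le0// addr0.
    have [u1|u1] := leP u 1 => /=.
      rewrite gkerE// -[leLHS]addr0 lerD ?mulr_ge0 ?expR_ge0//.
      by rewrite ler_piMr ?powR_ge0// expR_le1 oppr_le0 ltW.
    rewrite add0r /gker u0 ler_expR.
    have := @ln_gt0 R _ u1.
    by nra.
rewrite ge0_integralD//; last 4 first.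
- by move=> u _; rewrite lee_fin cutpow_ge0.
- by apply/measurable_EFinP; exact: measurable_cutpow.
- by move=> u _; rewrite lee_fin; case: ifP => // _; exact: expR_ge0.
- by apply/measurable_EFinP; exact: measurable_posexp.
rewrite integral_cutpow// mulrDl mulfV ?gt_eqF// mul1r EFinD leeD2l//.
by rewrite (le_trans (integral_posexp_le _ ltr01))// invr1.
Qed.

(** From e^(-u) >= 1 - u on ]0, 1] one gets Gamma(s) >= 1/s - 1/(s+1) >= 1/s - 1. The subtracted
    power is carried on the other side, as [cutpow (s + 1)], to stay with nonnegative integrands. *)
Lemma Gamma_fun_ge s : 0 < s -> 1 - s <= s * Gamma_fun s.
Proof.
move=> s0; have s10 : 0 < s + 1 by rewrite addr_gt0.
rewrite mulrC -ler_pdivrMr// mulrBl mulfV ?gt_eqF// mul1r lerBlDr.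
rewrite -lee_fin EFinD -GamE//.
apply: (@le_trans _ _ (Gam s + (s + 1)^-1%:E)%E); last first.
  by rewrite leeD2l// lee_fin invf_le1// lerDr ltW.
rewrite -!integral_cutpow// -ge0_integralD//; last 4 first.
- by move=> u _; rewrite lee_fin gker_ge0.
- by apply/measurable_EFinP; exact: measurable_gker.
- by move=> u _; rewrite lee_fin cutpow_ge0.
- by apply/measurable_EFinP; exact: measurable_cutpow.
apply: ge0_le_integral => //.
- by move=> u _; rewrite lee_fin cutpow_ge0.
- by apply/measurable_EFinP; exact: measurable_cutpow.
- apply: emeasurable_funD; first by apply/measurable_EFinP; exact: measurable_gker.
  by apply/measurable_EFinP; exact: measurable_cutpow.
move=> u _; rewrite -EFinD lee_fin /cutpow.
have [/andP[u0 u1]|_] := ifP; last by rewrite addr0 gker_ge0.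
rewrite gkerE// addrK powRB1// -[X in _ <= _ + X](@divfK _ u) ?(gt_eqF u0)//.
rewrite -mulrDr ler_peMr ?divr_ge0 ?powR_ge0 ?(ltW u0)//.
by have := expR_ge1Dx (- u); lra.
Qed.

End gamma_kernel.

(** * Gamma densities *)

(* Keeps unification from unfolding integrals. *)
Local Opaque Gamma_fun.

Section gamma_density.
Context {R : realType}.
Local Notation mu := (@lebesgue_measure R).
Implicit Types r s t u z : R.
Local Open Scope ereal_scope.

Definition heav u : \bar R := ((0 < u)%R%:R)%:E.

Lemma heav_gt0 u : (0 < u)%R -> heav u = 1.
Proof. by rewrite /heav => ->. Qed.

Lemma heav_le0 u : (u <= 0)%R -> heav u = 0.
Proof. by rewrite /heav ltNge => ->. Qed.

Lemma measurable_natr_bool d (T : measurableType d) (b : T -> bool) :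
  measurable_fun setT b -> measurable_fun setT (fun x => (b x)%:R : R).
Proof.
move=> mb; rewrite (_ : (fun _ => _) = (fun x => if b x then 1 else 0)%R).
  exact: measurable_fun_ifT.
by apply/funext => x; case: (b x).
Qed.

Lemma mfge0_heav : mfge0 heav.
Proof.
split=> [|u]; last by rewrite lee_fin ler0n.
apply/measurable_EFinP; apply: measurable_natr_bool.
exact: measurable_fun_ltr.
Qed.

Definition indoc s r : \bar R := ((0 < r <= s)%R%:R)%:E.

Lemma mfge0_indoc s : mfge0 (indoc s).
Proof.
split=> [|r]; last by rewrite lee_fin ler0n.
apply/measurable_EFinP; apply: measurable_natr_bool; apply: measurable_and.
  exact: measurable_fun_ltr.
exact: measurable_fun_ler.
Qed.

Definition gE s u : \bar R := (gker s u)%:E.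

Definition gdens s u : \bar R := (gker s u / Gamma_fun s)%:E.

Lemma Gamma_fun_ge0 s : (0 <= Gamma_fun s)%R.
Proof. by rewrite Gamma_funE fine_ge0// Gam_ge0. Qed.

Lemma gdensE s u : gdens s u = (Gamma_fun s)^-1%:E * gE s u.
Proof. by rewrite /gdens /gE -EFinM mulrC. Qed.

Lemma gdens_ge0 s u : 0 <= gdens s u.
Proof. by rewrite lee_fin divr_ge0 ?gker_ge0 ?Gamma_fun_ge0. Qed.

Lemma measurable_Gam : measurable_fun [set: R] (@Gam R).
Proof.
apply: (measurable_integral2 (fun w : R * R => (gker w.1 w.2)%:E)).
by apply/measurable_EFinP; exact: measurable_gker2.
Qed.

Lemma measurable_Gamma_fun : measurable_fun [set: R] (@Gamma_fun R).
Proof.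
rewrite (_ : @Gamma_fun R = fine \o @Gam R).
  by apply: measurableT_comp => //; exact: measurable_Gam.
by apply/funext => s; rewrite Gamma_funE.
Qed.

Lemma measurable_gdens2 :
  measurable_fun [set: R * R] (fun w : R * R => gdens w.1 w.2).
Proof.
apply/measurable_EFinP; apply: measurable_funM; first exact: measurable_gker2.
(* As a power the inverse is measurable on the whole line; both conventions give 0 at 0, so
   nonnegativity of [Gamma_fun] suffices. *)
rewrite (_ : (fun w : R * R => (Gamma_fun w.1)^-1)%R =
    (fun w : R * R => Gamma_fun w.1 `^ (-1))%R); last first.
  by apply/funext => w; rewrite powR_inv1// Gamma_fun_ge0.
apply: (measurableT_comp (measurable_powR _)).
by apply: measurableT_comp => //; exact: measurable_Gamma_fun.
Qed.

Lemma measurable_gdens_comp d (T : measurableType d) (p q : T -> R) :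
  measurable_fun setT p -> measurable_fun setT q ->
  measurable_fun setT (fun x => gdens (p x) (q x)).
Proof.
move=> mp mq.
have : measurable_fun setT (fun x => (p x, q x)) by exact: measurable_fun_pair.
exact: measurableT_comp measurable_gdens2.
Qed.

Lemma mfge0_gdens s : mfge0 (gdens s).
Proof.
split=> [|u]; last exact: gdens_ge0.
exact: measurable_gdens_comp.
Qed.

(* The substitution [u = z v]; the constant is the Beta function [B(r, s)]. *)
Lemma convol_gker_pow r s z : convol (gE r) (gE s) z =
  (expR 1)%:E * convol (gE r) (gE s) 1 * gE (r + s) z.
Proof.
have [z0|z0] := leP z 0%R.
  rewrite [gE (r + s) z]/gE [X in _ * X%:E]gker_le0// mule0; apply: integral0_eq => u _.
  rewrite /gE; have [u0|u0] := leP u 0%R; first by rewrite gker_le0// mul0e.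
  by rewrite [X in _ * X%:E]gker_le0 ?mule0//; lra.
rewrite /convol (ge0_integral_affine z 0)//; last 2 first.
- have [m1 _] := mfge0_gker r; have [m2 _] := mfge0_gker s.
  by apply: emeasurable_funM => //; exact: measurable_subl.
- by move=> u; rewrite mule_ge0// lee_fin gker_ge0.
have [m1 _] := mfge0_gker r; have [m2 _] := mfge0_gker s.
rewrite [RHS]muleAC -[LHS]ge0_integralZl//; last 3 first.
-
  apply: emeasurable_funM.
    by apply: (measurableT_comp m1); apply: measurable_funD => //; exact: measurable_funM.
  apply: (measurableT_comp m2); apply: measurable_funB => //.
  by apply: measurable_funD => //; exact: measurable_funM.
- by move=> u _; rewrite mule_ge0// lee_fin gker_ge0.
- by rewrite lee_fin ltW.
rewrite -[RHS]ge0_integralZl; last 4 first.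
- exact: measurableT.
- by apply: emeasurable_funM => //; exact: measurable_subl.
- by move=> u _; rewrite mule_ge0// lee_fin gker_ge0.
- by rewrite -EFinM lee_fin mulr_ge0 ?expR_ge0 ?gker_ge0.
apply: eq_integral => u _; rewrite addr0 /gE -!EFinM; congr EFin.
rewrite (_ : z - z * u = z * (1 - u))%R; last by ring.
rewrite !gkerM// (@gkerE _ (r + s) z)// !powRB1// powRD ?(gt_eqF z0) ?implybT//.
(* The two factors produced by [gkerM] multiply to e^(1-z). The e in it becomes the constant
   [expR 1], which compensates the e^(-1) hidden in the convolution at 1. *)
rewrite (_ : expR ((1 - z) * (1 - u)) =
  (expR ((1 - z) * u))^-1 * expR 1 * expR (- z))%R; last first.
  by rewrite -expRN -!expRD; congr expR; ring.
by field; rewrite !gt_eqF ?expR_gt0.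
Qed.

(* Integrating [convol_gker_pow] over [z] identifies the constant. *)
Lemma convol_gker r s z : (0 < r)%R -> (0 < s)%R -> convol (gE r) (gE s) z =
  (Gamma_fun r * Gamma_fun s / Gamma_fun (r + s))%:E * gE (r + s) z.
Proof.
move=> r0 s0; have rs0 : (0 < r + s)%R by rewrite addr_gt0.
rewrite convol_gker_pow; congr (_ * _).
set C := _ * _.
have C0 : 0 <= C.
  rewrite mule_ge0 ?lee_fin ?expR_ge0// integral_ge0// => u _.
  by rewrite mule_ge0// lee_fin gker_ge0.
have : \int[mu]_z convol (gE r) (gE s) z = C * (Gamma_fun (r + s))%:E.
  under eq_integral do rewrite convol_gker_pow.
  rewrite ge0_integralZl//; first by rewrite -GamE.
  - exact: (mfge0_gker _).1.
  - by move=> u _; rewrite lee_fin gker_ge0.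
rewrite integral_convol; [|exact: mfge0_gker..].
rewrite -!/(Gam _) !GamE// => E.
by rewrite EFinM EFinM E -muleA -EFinM divff ?mule1// gt_eqF// Gamma_fun_gt0.
Qed.

Lemma convol_gker_gdens r s : (0 < r)%R -> (0 < s)%R ->
  convol (gE s) (gdens r) = fun z => (Gamma_fun s)%:E * gdens (s + r) z.
Proof.
move=> r0 s0; apply/funext => z.
have -> : gdens r = (fun u => (Gamma_fun r)^-1%:E * gE r u).
  by apply/funext => u; rewrite gdensE.
rewrite convolZr//; [|by rewrite lee_fin invr_ge0 Gamma_fun_ge0|exact: mfge0_gker..].
rewrite convol_gker// gdensE !muleA -!EFinM; congr EFin.
rewrite (addrC s r).
have := Gamma_fun_gt0 _ r0; have := Gamma_fun_gt0 _ (addr_gt0 r0 s0).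
move: (Gamma_fun r) (Gamma_fun s) (Gamma_fun (r + s)) (gker _ z).
move=> gr gs grs k grs0 gr0.
by field; rewrite !gt_eqF.
Qed.

(** The distribution function F_r, written as a convolution with the Heaviside function so that
    associativity of [convol] applies to it. *)
Definition gcdf r := convol heav (gdens r).

(* The upper incomplete Gamma function, extended by 0 to [x <= 0]; [tailg 0] is
   the exponential integral [E_1]. *)
Definition tailg s x := \int[mu]_u ((0 < x <= u)%R%:R * gker s u)%:E.

Lemma measurable_tailg_integrand2 s : measurable_fun [set: R * R]
  (fun w : R * R => ((0 < w.1 <= w.2)%R%:R * gker s w.2)%:E).
Proof.
apply/measurable_EFinP; apply: measurable_funM.
  apply: measurable_natr_bool; apply: measurable_and.
    exact: measurable_fun_ltr.
  exact: measurable_fun_ler.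
by apply: (measurableT_comp (measurable_gker s)).
Qed.

Lemma mfge0_tailg s : mfge0 (tailg s).
Proof.
split=> [|x]; last first.
  by apply: integral_ge0 => u _; rewrite lee_fin mulr_ge0 ?gker_ge0.
exact: (measurable_integral2 _ (measurable_tailg_integrand2 s)).
Qed.

(** For x > 0 the Gamma integral is cut at u = x; for x <= 0 every term vanishes. The form as a sum
    remains meaningful when [Gam s] is infinite. *)
Lemma tailg_split s x : tailg s x + convol heav (gE s) x = Gam s * heav x.
Proof.
rewrite convolC; [|exact: mfge0_heav|exact: mfge0_gker].
have m1 : measurable_fun [set: R] (fun u => ((0 < x <= u)%R%:R * gker s u)%:E).
  exact: (measurableT_comp (measurable_tailg_integrand2 s) (pair1_measurable x)).
have [mg _] := mfge0_gker s; have [mh h0] := mfge0_heav.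
rewrite -ge0_integralD//; last 3 first.
- by move=> u _; rewrite lee_fin mulr_ge0 ?gker_ge0.
- by move=> u _; rewrite mule_ge0// lee_fin gker_ge0.
- by apply: emeasurable_funM => //; exact: measurable_subl.
rewrite /Gam -ge0_integralZr//; last by move=> u _; rewrite lee_fin gker_ge0.
apply: eq_integral => u _; rewrite /heav /gE -!EFinM -EFinD; congr EFin.
have [u0|u0] := leP u 0%R; first by rewrite gker_le0// !(mul0r, mulr0) addr0.
rewrite subr_gt0; have [xu|xu] := leP x u => /=.
  by rewrite mulr0 addr0 andbT mulrC.
by rewrite andbF mul0r add0r (lt_trans u0 xu).
Qed.

(** Convolve [tailg_split] with [gdens r]: the second term becomes Gamma(s) F_(s+r) by associativity
    and the semigroup law of the Gamma densities. *)
Lemma convol_tailg_gdens r s z : (0 < r)%R -> (0 < s)%R ->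
  convol (tailg s) (gdens r) z + (Gamma_fun s)%:E * gcdf (s + r) z =
  (Gamma_fun s)%:E * gcdf r z.
Proof.
move=> r0 s0; have hh := mfge0_heav; have hg := mfge0_gdens r.
have hk := mfge0_gker s; have ht := mfge0_tailg s.
have G0 : 0 <= (Gamma_fun s)%:E by rewrite lee_fin Gamma_fun_ge0.
have E1 : convol (convol heav (gE s)) (gdens r) z =
    (Gamma_fun s)%:E * gcdf (s + r) z.
  rewrite (convolA _ _ _ hh hk hg) (convol_gker_gdens _ _ r0 s0).
  exact: (convolZr _ _ _ _ G0 hh (mfge0_gdens (s + r))).
have E2 : convol (fun x => Gam s * heav x) (gdens r) z =
    (Gamma_fun s)%:E * gcdf r z.
  by rewrite -(GamE _ s0); exact: (convolZl _ _ _ _ (Gam_ge0 s) hh hg).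
apply: etrans E2.
transitivity (convol (tailg s) (gdens r) z +
              convol (convol heav (gE s)) (gdens r) z).
  by congr (_ + _); exact: esym E1.
refine (etrans (esym (convolDl _ _ _ z ht (mfge0_convol _ _ hh hk) hg)) _).
by congr (convol _ _ z); apply/funext => x; exact: tailg_split.
Qed.

(* The kernel [S] as a mixture of Gamma densities. *)
Definition Smix t := \int[mu]_r (heav r * gdens r t).

Lemma measurable_Smix_integrand : measurable_fun [set: R * R]
  (fun w : R * R => heav w.2 * gdens w.2 w.1).
Proof.
have [mh _] := mfge0_heav.
apply: emeasurable_funM; first exact: measurableT_comp.
exact: measurable_gdens_comp.
Qed.

Lemma mfge0_Smix : mfge0 Smix.
Proof.
split=> [|x]; last first.
  by apply: integral_ge0 => u _; rewrite mule_ge0 ?gdens_ge0//; exact: (mfge0_heav).2.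
exact: (measurable_integral2 _ measurable_Smix_integrand).
Qed.

Lemma convol_Smix f z : mfge0 f ->
  convol f Smix z = \int[mu]_r (heav r * convol f (gdens r) z).
Proof.
move=> [mf f0]; have [mh h0] := mfge0_heav.
transitivity (\int[mu]_u \int[mu]_r (f u * (heav r * gdens r (z - u)%R))).
  apply: eq_integral => u _; rewrite ge0_integralZl//.
  - exact: (measurableT_comp measurable_Smix_integrand (pair1_measurable (z - u)%R)).
  - by move=> r _; rewrite mule_ge0 ?gdens_ge0.
rewrite (ge0_integralC (fun u r => f u * (heav r * gdens r (z - u)%R))); last 2 first.
- apply: emeasurable_funM; first exact: measurableT_comp.
  apply: emeasurable_funM; first exact: measurableT_comp.
  by apply: measurable_gdens_comp => //; exact: measurable_funB.
- by move=> u r; rewrite !mule_ge0 ?gdens_ge0.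
apply: eq_integral => r _; rewrite -ge0_integralZl//.
- by apply: eq_integral => u _; rewrite muleCA.
- by apply: emeasurable_funM => //; apply: measurable_subl; exact: (mfge0_gdens r).1.
- by move=> u _; rewrite mule_ge0 ?gdens_ge0.
Qed.

Lemma measurable_gcdf z : measurable_fun [set: R] (gcdf ^~ z).
Proof.
have [mh _] := mfge0_heav.
apply: (measurable_integral2 (fun w : R * R => heav w.2 * gdens w.1 (z - w.2)%R)).
apply: emeasurable_funM; first exact: measurableT_comp.
by apply: measurable_gdens_comp => //; exact: measurable_funB.
Qed.

Lemma gcdf_ge0 r z : 0 <= gcdf r z.
Proof. by have [_] := mfge0_convol _ _ mfge0_heav (mfge0_gdens r); apply. Qed.

(* Chernoff's bound: [1_(u < z) <= e^(z - u)]. *)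
Lemma gcdf_exp_le r z : (0 < r)%R ->
  gcdf r z <= (expR z)%:E * (expR (- ln 2 * r))%:E.
Proof.
move=> r0; have hg := mfge0_gdens r; have hh := mfge0_heav.
have mgk : measurable_fun [set: R] (fun u => (expR (- u) * gker r u)%:E).
  apply/measurable_EFinP; apply: measurable_funM; last exact: measurable_gker.
  by apply: measurableT_comp => //; exact: measurable_funN.
have gk0 u : 0 <= (expR (- u) * gker r u)%:E.
  by rewrite lee_fin mulr_ge0 ?expR_ge0 ?gker_ge0.
(* The Laplace transform of the Gamma(r) density at 1 is 2^(-r), by the substitution of 2u for u.
   The power is spelled [expR (- ln 2 * r)] so that it can be integrated in [r] as an exponential of
   rate ln 2. *)
have E : \int[mu]_u (expR (- u) * gker r u)%:E =
    (expR (- ln 2 * r) * Gamma_fun r)%:E.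
  have : Gam r = (2 `^ r)%:E * \int[mu]_u (expR (- u) * gker r u)%:E.
    rewrite {1}/Gam (ge0_integral_affine 2 0)//; last 2 first.
    - exact: (mfge0_gker r).1.
    - by move=> u; rewrite lee_fin gker_ge0.
    rewrite -!ge0_integralZl//; last 2 first.
    - apply/measurable_EFinP; apply: (measurableT_comp (measurable_gker r)).
      by apply: measurable_funD => //; exact: measurable_funM.
    - by move=> u _; rewrite lee_fin gker_ge0.
    apply: eq_integral => u _; rewrite addr0 -!EFinM gkerM// powRB1//.
    congr EFin; rewrite (_ : (1 - 2) * u = - u)%R; last by ring.
    by field.
  rewrite GamE// => H; rewrite EFinM H muleA -EFinM.
  rewrite /powR pnatr_eq0/= -expRD (_ : - ln 2 * r + r * ln 2 = 0)%R; last by ring.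
  by rewrite expR0 mul1e.
rewrite /gcdf convolC// /convol.
apply: (@le_trans _ _ (\int[mu]_u ((expR z / Gamma_fun r)%:E *
    (expR (- u) * gker r u)%:E))).
  apply: ge0_le_integral => //.
  - by move=> u _; rewrite mule_ge0 ?gdens_ge0//; exact: hh.2.
  - by apply: emeasurable_funM; [exact: hg.1|exact: measurable_subl hh.1].
  - exact: emeasurable_funM.
  - move=> u _; rewrite /gdens /heav -!EFinM lee_fin.
    rewrite (_ : expR z / Gamma_fun r * (expR (- u) * gker r u) =
      gker r u / Gamma_fun r * expR (z - u))%R; last by rewrite expRD; ring.
    apply: ler_wpM2l; first by rewrite divr_ge0 ?gker_ge0 ?Gamma_fun_ge0.
    have [zu|zu] := ltP 0%R (z - u)%R; last exact: expR_ge0.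
    by rewrite -expR0 ler_expR ltW.
rewrite ge0_integralZl//; last by rewrite lee_fin divr_ge0 ?expR_ge0 ?Gamma_fun_ge0.
rewrite E -!EFinM lee_fin le_eqVlt; apply/orP; left; apply/eqP.
by field; rewrite gt_eqF// Gamma_fun_gt0.
Qed.

(** Chernoff's bound decays geometrically in [r]. This finiteness permits the cancellation in
    [integral_telescope] and bounds the error term in [convol_tailg0_ge1]. *)
Lemma integral_gcdf_lty z : \int[mu]_r (heav r * gcdf r z) < +oo.
Proof.
have [mh h0] := mfge0_heav.
have ln20 : (0 < ln 2 :> R)%R by rewrite ln_gt0// ltr1n.
have mp : measurable_fun [set: R]
    (fun r => (if 0 < r then expR (- ln 2 * r) else 0)%R%:E).
  by apply/measurable_EFinP; exact: measurable_posexp.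
apply: (@le_lt_trans _ _ (\int[mu]_r ((expR z)%:E *
    (if 0 < r then expR (- ln 2 * r) else 0)%R%:E))).
  apply: ge0_le_integral => //.
  - by move=> r _; rewrite mule_ge0 ?gcdf_ge0.
  - by apply: emeasurable_funM => //; exact: measurable_gcdf.
  - exact: emeasurable_funM.
  - move=> r _; have [r0|r0] := ltP 0%R r.
      by rewrite heav_gt0// mul1e gcdf_exp_le.
    by rewrite heav_le0// mul0e mule0.
rewrite ge0_integralZl//; last first.
  by move=> r _; rewrite lee_fin; case: ifP => // _; exact: expR_ge0.
apply: (@le_lt_trans _ _ ((expR z)%:E * (ln 2)^-1%:E)); last by rewrite -EFinM ltry.
by rewrite lee_wpmul2l ?lee_fin ?expR_ge0// integral_posexp_le.
Qed.

(** Shifting by [s] turns the integral of F(s + r) over r > 0 into that of F over r > s. This tail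
    is also part of the integral of F over r > 0; being finite, it cancels and leaves ]0, s]. *)
Lemma integral_telescope (A F : R -> \bar R) c s : (0 <= c)%R -> (0 < s)%R ->
  mfge0 A -> mfge0 F -> \int[mu]_r (heav r * F r) < +oo ->
  (forall r, (0 < r)%R -> A r + c%:E * F (s + r)%R = c%:E * F r) ->
  \int[mu]_r (heav r * A r) =
  c%:E * \int[mu]_r (indoc s r * F r).
Proof.
move=> c0 s0 [mA A0] [mF F0] Foo AF; have [mh h0] := mfge0_heav.
have mFs : measurable_fun [set: R] (fun r => F (s + r)%R).
  by apply: (measurableT_comp mF); exact: measurable_funD.
have mhs : measurable_fun [set: R] (fun r => heav (r - s)).
  by apply: (measurableT_comp mh); exact: measurable_funB.
have [mN i0] := mfge0_indoc s.
have H1 : \int[mu]_r (heav r * A r) +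
      c%:E * \int[mu]_r (heav r * F (s + r)%R) =
    c%:E * \int[mu]_r (heav r * F r).
  rewrite -!ge0_integralZl//; last 4 first.
  - exact: emeasurable_funM.
  - by move=> r _; rewrite mule_ge0.
  - exact: emeasurable_funM.
  - by move=> r _; rewrite mule_ge0.
  rewrite -ge0_integralD//; last 4 first.
  - by move=> r _; rewrite mule_ge0.
  - exact: emeasurable_funM.
  - by move=> r _; rewrite !mule_ge0.
  - by apply: emeasurable_funM => //; exact: emeasurable_funM.
  apply: eq_integral => r _; have [r0|r0] := ltP 0%R r.
    by rewrite heav_gt0// !mul1e AF.
  by rewrite heav_le0// !mul0e mule0 adde0.
have H2 : \int[mu]_r (heav r * F (s + r)%R) = \int[mu]_r (heav (r - s) * F r).
  rewrite -[RHS](ge0_integral_shift s)//.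
  - by apply: eq_integral => r _; rewrite addrK addrC.
  - exact: emeasurable_funM.
  - by move=> r; rewrite mule_ge0.
have H3 : \int[mu]_r (heav r * F r) =
    \int[mu]_r (indoc s r * F r) +
    \int[mu]_r (heav (r - s) * F r).
  rewrite -ge0_integralD//; last 4 first.
  - by move=> r _; rewrite mule_ge0// lee_fin ler0n.
  - exact: emeasurable_funM.
  - by move=> r _; rewrite mule_ge0.
  - exact: emeasurable_funM.
  apply: eq_integral => r _; rewrite -ge0_muleDl//.
  congr (_ * _); rewrite /heav /indoc -EFinD; congr EFin; rewrite subr_gt0.
  have [rs|rs] := leP r s; first by rewrite andbT addr0.
  by rewrite andbF add0r (lt_trans s0 rs).
have N0 : 0 <= \int[mu]_r (indoc s r * F r).
  by apply: integral_ge0 => r _; rewrite mule_ge0// lee_fin ler0n.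
have K0 : 0 <= \int[mu]_r (heav (r - s) * F r).
  by apply: integral_ge0 => r _; rewrite mule_ge0.
have Kfin : c%:E * \int[mu]_r (heav (r - s) * F r) \is a fin_num.
  rewrite fin_numM// ge0_fin_numE// (le_lt_trans _ Foo)//.
  by rewrite H3 leeDr.
move: H1; rewrite H2 H3 (@ge0_muleDr _ c%:E _ _ N0 K0) => H1.
by rewrite -[LHS](addeK _ Kfin) H1 addeK.
Qed.

Lemma convol_tailg_Smix s z : (0 < s)%R ->
  convol (tailg s) Smix z =
  (Gamma_fun s)%:E * \int[mu]_r (indoc s r * gcdf r z).
Proof.
move=> s0; rewrite (convol_Smix _ z (mfge0_tailg s)).
apply: integral_telescope => //.
- exact: Gamma_fun_ge0.
- split=> [|r]; last first.
    by have [_] := mfge0_convol _ _ (mfge0_tailg s) (mfge0_gdens r); apply.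
  apply: (measurable_integral2
    (fun w : R * R => tailg s w.2 * gdens w.1 (z - w.2)%R)).
  apply: emeasurable_funM; first exact: (measurableT_comp (mfge0_tailg s).1).
  by apply: measurable_gdens_comp => //; exact: measurable_funB.
- by split=> [|r]; [exact: measurable_gcdf|exact: gcdf_ge0].
- exact: integral_gcdf_lty.
- by move=> r r0; exact: convol_tailg_gdens.
Qed.

End gamma_density.

(** * The Sonine identity *)

Section sonine.
Context {R : realType}.
Local Notation mu := (@lebesgue_measure R).
Implicit Types r s t u x z : R.
Local Open Scope ereal_scope.

Lemma tailg_gcdf r z : (0 < r)%R -> (0 < z)%R ->
  tailg r z + (Gamma_fun r)%:E * gcdf r z = (Gamma_fun r)%:E.
Proof.
move=> r0 z0; have G0 : 0 <= (Gamma_fun r)%:E by rewrite lee_fin Gamma_fun_ge0.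
have -> : (Gamma_fun r)%:E * gcdf r z = convol heav (gE r) z.
  rewrite /gcdf -(convolZr _ _ _ z G0 mfge0_heav (mfge0_gdens r)).
  congr (convol _ _ z); apply/funext => u.
  by rewrite /gdens -EFinM mulrC divfK// gt_eqF// Gamma_fun_gt0.
by rewrite tailg_split heav_gt0// mule1 GamE.
Qed.

Lemma tailg_ge0 s x : 0 <= tailg s x.
Proof. exact: (mfge0_tailg s).2. Qed.

Lemma tailg_le0 s x : (x <= 0)%R -> tailg s x = 0.
Proof.
by move=> x0; apply: integral0_eq => u _; rewrite ltNge x0/= mul0r.
Qed.

Lemma measurable_tailg_integrand s x :
  measurable_fun [set: R] (fun u => ((0 < x <= u)%R%:R * gker s u)%:E).
Proof.
exact: (measurableT_comp (measurable_tailg_integrand2 s) (pair1_measurable x)).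
Qed.

Lemma tailg_integrand_ge0 s x u : 0 <= ((0 < x <= u)%R%:R * gker s u)%:E.
Proof. by rewrite lee_fin mulr_ge0 ?gker_ge0. Qed.

Lemma posexp_ge0 c u : 0 <= (if (0 < u)%R then expR (- c * u) else 0%R)%:E.
Proof. by rewrite lee_fin; case: ifP => // _; exact: expR_ge0. Qed.

Lemma measurable_posexpE c :
  measurable_fun [set: R] (fun u => (if (0 < u)%R then expR (- c * u) else 0%R)%:E).
Proof. by apply/measurable_EFinP; exact: measurable_posexp. Qed.

Lemma tailg0_lty x : tailg 0 x < +oo.
Proof.
have [x0|x0] := leP x 0%R; first by rewrite tailg_le0.
apply: (@le_lt_trans _ _ (\int[mu]_u ((x^-1)%:E *
    (if (0 < u)%R then expR (- 1 * u) else 0%R)%:E))).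
  apply: ge0_le_integral => //.
  - by move=> u _; exact: tailg_integrand_ge0.
  - exact: measurable_tailg_integrand.
  - by apply: emeasurable_funM => //; exact: measurable_posexpE.
  - move=> u _; rewrite -EFinM lee_fin; have [u0|u0] := ltP 0%R u; last first.
      by rewrite gker_le0// !mulr0.
    rewrite x0/=; have [xu|xu] := leP x u; last first.
      by rewrite mul0r mulr_ge0 ?expR_ge0// invr_ge0 ltW.
    rewrite mul1r gkerE// powRB1// powRr0 mul1r mulN1r.
    by rewrite ler_wpM2r ?expR_ge0// lef_pV2.
rewrite ge0_integralZl//; last 3 first.
- exact: measurable_posexpE.
- by move=> u _; exact: posexp_ge0.
- by rewrite lee_fin invr_ge0 ltW.
apply: (@le_lt_trans _ _ ((x^-1)%:E * 1^-1%:E)); last by rewrite -EFinM ltry.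
by rewrite lee_wpmul2l ?lee_fin ?invr_ge0 ?(ltW x0)// integral_posexp_le.
Qed.

(* For [u > 1] this is [u^s - 1 <= s u], a weak form of Bernoulli's inequality. *)
Lemma gker_le_gker0 s u : (0 <= s <= 1)%R -> (0 < u)%R ->
  (gker s u <= gker 0 u + s * expR (- u))%R.
Proof.
move=> /andP[s0 s1] u0; rewrite /gker u0 sub0r mulN1r.
have [u1|u1] := leP u 1%R.
  rewrite -[leLHS]addr0 lerD ?mulr_ge0 ?expR_ge0// ler_expR lerD2r.
  by have := ln_le0 u1; nra.
have w0 := ln_gt0 u1; set w := ln u in w0 *.
have -> : expR ((s - 1) * w - u) = (expR (s * w) * expR (- w) * expR (- u))%R.
  by rewrite -!expRD; congr expR; ring.
rewrite expRD -mulrDl ler_wpM2r ?expR_ge0//.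
rewrite -[X in (_ <= _ + X)%R](_ : s * expR w * expR (- w) = s)%R; last first.
  by rewrite -mulrA expRxMexpNx_1 mulr1.
rewrite -[X in (_ <= X + _)%R]mul1r -mulrDl ler_wpM2r ?expR_ge0//.
(* With A = u^s and B = u^(1-s), so that AB = u, the bound e^y >= 1 + y gives A (1 - s w) <= 1 and B
   >= 1 + (1-s) w. Weighting the first by 1 - s and the second by s A cancels the terms in w = ln u
   and yields A <= 1 - s + s u. *)
have := expR_ge1Dx (- (s * w)); rewrite expRN => h1.
have A0 := expR_gt0 (s * w).
have h1' : (expR (s * w) * (1 - s * w) <= 1)%R.
  by rewrite mulrC -ler_pdivlMr// mul1r.
have -> : expR w = (expR (s * w) * expR ((1 - s) * w))%R.
  by rewrite -expRD; congr expR; ring.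
have h2 := expR_ge1Dx ((1 - s) * w).
move: (expR (s * w)) (expR ((1 - s) * w)) h1' A0 h2 {h1} => A B h1 A0 h2.
have h3 : (s * A * (1 + (1 - s) * w) <= s * A * B)%R.
  by rewrite ler_wpM2l// mulr_ge0// ltW.
have h4 : ((1 - s) * (A * (1 - s * w)) <= (1 - s) * 1)%R.
  by rewrite ler_wpM2l// subr_ge0.
lra.
Qed.

Lemma tailg_le s x : (0 <= s <= 1)%R -> tailg s x <= tailg 0 x + s%:E * heav x.
Proof.
move=> s01; have [s0 s1] := andP s01.
have [x0|x0] := leP x 0%R.
  by rewrite !tailg_le0// add0e mule_ge0//; exact: mfge0_heav.2.
rewrite heav_gt0// mule1.
apply: (@le_trans _ _ (\int[mu]_u (((0 < x <= u)%R%:R * gker 0 u)%:E +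
   s%:E * (if (0 < u)%R then expR (- 1 * u) else 0%R)%:E))).
  apply: ge0_le_integral => //.
  - by move=> u _; exact: tailg_integrand_ge0.
  - exact: measurable_tailg_integrand.
  - apply: emeasurable_funD; first exact: measurable_tailg_integrand.
    by apply: emeasurable_funM => //; exact: measurable_posexpE.
  - move=> u _; rewrite -EFinM -EFinD lee_fin; have [u0|u0] := ltP 0%R u; last first.
      by rewrite !gker_le0// !mulr0 addr0.
    rewrite x0/= mulN1r; have [xu|xu] := leP x u; last first.
      by rewrite !mul0r add0r mulr_ge0 ?expR_ge0.
    by rewrite !mul1r gker_le_gker0.
rewrite ge0_integralD//; last 4 first.
- by move=> u _; exact: tailg_integrand_ge0.
- exact: measurable_tailg_integrand.
- by move=> u _; rewrite mule_ge0//; exact: posexp_ge0.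
- by apply: emeasurable_funM => //; exact: measurable_posexpE.
rewrite ge0_integralZl//; last 2 first.
- exact: measurable_posexpE.
- by move=> u _; exact: posexp_ge0.
apply: leeD2l; rewrite -[leRHS]mule1 lee_wpmul2l// ?lee_fin//.
by rewrite (le_trans (integral_posexp_le _ ltr01))// invr1.
Qed.

(** Because u^s >= x^s for u >= x. The left-hand side tends to [tailg 0 x] by mere continuity of s
    |-> x^s, so the limit of the incomplete Gamma function itself never has to be computed. *)
Lemma powR_tailg_le s x : (0 <= s)%R -> (x `^ s)%:E * tailg 0 x <= tailg s x.
Proof.
move=> s0; have [x0|x0] := leP x 0%R; first by rewrite !tailg_le0// mule0.
rewrite -ge0_integralZl//; last 3 first.
- exact: measurable_tailg_integrand.
- by move=> u _; exact: tailg_integrand_ge0.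
- by rewrite lee_fin powR_ge0.
apply: ge0_le_integral => //.
- by move=> u _; rewrite mule_ge0 ?tailg_integrand_ge0// lee_fin powR_ge0.
- by apply: emeasurable_funM => //; exact: measurable_tailg_integrand.
- exact: measurable_tailg_integrand.
- move=> u _; rewrite -EFinM lee_fin x0/=; have [xu|xu] := leP x u; last first.
    by rewrite !mul0r mulr0.
  rewrite !mul1r /gker; case: ifP => u0; last by rewrite mulr0.
  rewrite /powR (gt_eqF x0) -expRD ler_expR.
  have : (ln x <= ln u)%R by rewrite ler_ln.
  by move=> h; have := ler_wpM2l s0 h; lra.
Qed.

(** * Gamma distribution functions of small order *)

Lemma gcdf_le1 r z : (0 < r)%R -> (0 < z)%R -> gcdf r z <= 1.
Proof.
move=> r0 z0; have G0 := Gamma_fun_gt0 _ r0.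
rewrite -(@lee_pmul2l _ (Gamma_fun r)%:E)// mule1.
by rewrite -[leRHS](tailg_gcdf _ _ r0 z0) leeDr// tailg_ge0.
Qed.

Lemma integral_indoc s : (0 <= s)%R ->
  \int[mu]_r indoc s r = s%:E.
Proof.
move=> s0; transitivity (\int[mu]_r (cst 1 \_ `]0%R, s]) r).
  apply: eq_integral => r _; rewrite patchE mem_setE in_itv/= /indoc.
  by case: ifP.
rewrite -integral_mkcond integral_cst//= mul1e lebesgue_measure_itv/= lte_fin.
by case: ltgtP s0 => // [_ _|<- _]; rewrite ?oppr0 ?adde0 //.
Qed.

Lemma mfge0_indoc_gcdf s z : mfge0 (fun r => indoc s r * gcdf r z).
Proof.
have [mi i0] := mfge0_indoc s.
by split=> [|r]; [apply: emeasurable_funM => //; exact: measurable_gcdf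
  |rewrite mule_ge0// gcdf_ge0].
Qed.

Lemma integral_indoc_gcdf_le s z : (0 <= s)%R -> (0 < z)%R ->
  \int[mu]_r (indoc s r * gcdf r z) <= s%:E.
Proof.
move=> s0 z0; have [mi i0] := mfge0_indoc s.
have [mF F0] := mfge0_indoc_gcdf s z.
rewrite -(integral_indoc _ s0); apply: ge0_le_integral => //.
move=> r _; rewrite /indoc; have [r0|r0] := ltP 0%R r; last by rewrite mul0e.
rewrite -[leRHS]mule1 lee_wpmul2l ?lee_fin ?ler0n//.
exact: gcdf_le1.
Qed.

Lemma convol_tailg_le s z : (0 < s <= 1)%R -> (0 < z)%R ->
  convol (tailg s) Smix z <= (1 + s)%:E.
Proof.
move=> /andP[s0 s1] z0; rewrite convol_tailg_Smix//.
apply: (@le_trans _ _ ((Gamma_fun s)%:E * s%:E)).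
  apply: lee_wpmul2l; first by rewrite lee_fin Gamma_fun_ge0.
  by apply: integral_indoc_gcdf_le => //; exact: ltW.
by rewrite -EFinM lee_fin mulrC Gamma_fun_le// s0.
Qed.

Lemma gcdf_fin r z : (0 < r)%R -> (0 < z)%R -> gcdf r z \is a fin_num.
Proof.
move=> r0 z0; rewrite ge0_fin_numE ?gcdf_ge0//.
by rewrite (le_lt_trans (gcdf_le1 _ _ r0 z0))// ltry.
Qed.

(** One has 1 - F_r(z) = r Gamma(r, z) / (r Gamma(r)). The numerator is at most s (E_1(z) + 1) by
    [tailg_le], and the denominator is at least 1 - r >= 1/2. The bound is uniform in r <= s, ready
    to be integrated over ]0, s]. *)
Lemma gcdf_lb r s z : (0 < r <= s)%R -> (s <= 2^-1)%R -> (0 < z)%R ->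
  1 <= gcdf r z + (2 * s * (fine (tailg 0 z) + 1))%:E.
Proof.
move=> /andP[r0 rs] s2 z0.
have := gcdf_le1 _ _ r0 z0; have := tailg_gcdf _ _ r0 z0.
have r1 : (0 <= r <= 1)%R by apply/andP; split; lra.
have := tailg_le _ z r1; rewrite heav_gt0// mule1.
have := tailg0_lty z; have := tailg_ge0 0 z.
case: (tailg 0 z) => // q q0 _ /=.
have := tailg_ge0 r z; case: (tailg r z) => // p p0.
rewrite lee_fin => pq.
rewrite -(fineK (gcdf_fin _ _ r0 z0)); move: (fine _) => g.
have G0 := Gamma_fun_gt0 _ r0; have G1 := Gamma_fun_ge _ r0.
rewrite -EFinM -!EFinD => -[] H; rewrite !lee_fin => g1.
rewrite !lee_fin in p0 q0.
have h1 : ((1 - r) * (1 - g) <= r * Gamma_fun r * (1 - g))%R.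
  by rewrite ler_wpM2r// subr_ge0.
have h2 : (r * Gamma_fun r * (1 - g) = r * p)%R.
  by rewrite (_ : p = Gamma_fun r - Gamma_fun r * g)%R; [ring|rewrite -{1}H addrK].
have h3 : (r * p <= s * (q + 1))%R by apply: ler_pM => //; lra.
have h4 : (2^-1 * (1 - g) <= (1 - r) * (1 - g))%R by rewrite ler_wpM2r//; lra.
lra.
Qed.

Lemma integral_indoc_gcdf_ge s z : (0 < s <= 2^-1)%R -> (0 < z)%R ->
  s%:E <= \int[mu]_r (indoc s r * gcdf r z) +
     (2 * s * (fine (tailg 0 z) + 1) * s)%:E.
Proof.
move=> /andP[s0 s2] z0; have [mi i0] := mfge0_indoc s.
have [mF F0] := mfge0_indoc_gcdf s z.
set c := (2 * s * _)%R; have c0 : (0 <= c)%R.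
  by rewrite mulr_ge0 ?mulr_ge0 ?(ltW s0)// addr_ge0// fine_ge0// tailg_ge0.
rewrite EFinM -(integral_indoc s (ltW s0)) -ge0_integralZl//.
rewrite -ge0_integralD//; last 2 first.
- by move=> r _; rewrite mule_ge0 ?lee_fin.
- by apply: emeasurable_funM => //; exact: mi.
apply: ge0_le_integral => //.
  by apply: emeasurable_funD => //; exact: emeasurable_funM.
move=> r _; rewrite /indoc; case: (boolP (0 < r <= s)%R) => [r0s|_]; last first.
  by rewrite !(mul0e, mule0) adde0.
by rewrite mul1e mule1; exact: gcdf_lb.
Qed.

Lemma convol_tailg0_ge1 z : (0 < z)%R -> 1 <= convol (tailg 0) Smix z.
Proof.
move=> z0; set K := convol (tailg 0) Smix z.
pose m := fine (\int[mu]_r (heav r * gcdf r z)).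
have M0 : 0 <= \int[mu]_r (heav r * gcdf r z).
  by apply: integral_ge0 => r _; rewrite mule_ge0 ?gcdf_ge0//; exact: mfge0_heav.2.
have m0 : (0 <= m)%R by rewrite fine_ge0.
have mE : \int[mu]_r (heav r * gcdf r z) = m%:E.
  by rewrite fineK// ge0_fin_numE// integral_gcdf_lty.
pose q := (fine (tailg 0 z) + 1)%R.
have q1 : (1 <= q)%R by rewrite lerDr fine_ge0// tailg_ge0.
(* The constant collects three errors of order s: [m] is the convolution of [heav] with [Smix] left
   by [tailg_le], 1 comes from s Gamma(s) >= 1 - s, and 4q is the defect 2 s q of the distribution
   functions multiplied by s Gamma(s) <= 2. *)
have main s : (0 < s <= 2^-1)%R -> 1 <= K + (s * (m + 1 + 4 * q))%:E.
  move=> s02; have [s0 s2] := andP s02.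
  have H1 : convol (tailg s) Smix z <= K + (s * m)%:E.
    apply: (@le_trans _ _ (convol (fun x => tailg 0 x + s%:E * heav x) Smix z)).
      apply: le_convoll; [exact: mfge0_tailg| |exact: mfge0_Smix|].
        split=> [|x].
          apply: emeasurable_funD; first exact: (mfge0_tailg 0).1.
          by apply: emeasurable_funM; [exact: measurable_cst|exact: mfge0_heav.1].
        rewrite adde_ge0 ?tailg_ge0// mule_ge0 ?lee_fin ?(ltW s0)//.
      by move=> x; apply: tailg_le; apply/andP; split; lra.
    rewrite convolDl; [|exact: mfge0_tailg| |exact: mfge0_Smix]; last first.
      split=> [|x]; first by apply: emeasurable_funM; [exact: measurable_cst|exact: mfge0_heav.1].
      by rewrite mule_ge0 ?lee_fin ?(ltW s0).
    rewrite (@convolZl _ _ _ _ _ _ mfge0_heav mfge0_Smix); last first.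
      by rewrite lee_fin ltW.
    by rewrite (convol_Smix _ z mfge0_heav) -/(gcdf _ _) mE.
  have H2 := integral_indoc_gcdf_ge _ _ s02 z0.
  have H3 := integral_indoc_gcdf_le _ _ (ltW s0) z0.
  have [_ H4] := mfge0_indoc_gcdf s z.
  have H5 : 0 <= \int[mu]_r (indoc s r * gcdf r z) by apply: integral_ge0.
  move: H1; rewrite (convol_tailg_Smix _ _ s0).
    move: (\int[mu]_r _) H2 H3 H5 => N; case: N => // n; rewrite -/q.
  rewrite -!EFinD !lee_fin => H2 H3 H5.
  have G1 := Gamma_fun_ge _ s0.
  have G2 : (s * Gamma_fun s <= 1 + s)%R by apply: Gamma_fun_le; apply/andP; split; lra.
  have Gp := Gamma_fun_gt0 _ s0.
  rewrite -EFinM => H1; apply: (@le_trans _ _ ((Gamma_fun s * n)%:E + (s * (1 + 4 * q))%:E)).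
    rewrite -EFinD lee_fin.
    have : (Gamma_fun s * s <= Gamma_fun s * (n + 2 * s * q * s))%R.
      by rewrite ler_wpM2l// ltW.
    have : (s * Gamma_fun s * (s * q) <= 2 * (s * q))%R.
      by rewrite ler_wpM2r//; [rewrite mulr_ge0//; lra|lra].
    lra.
  rewrite (_ : s * (m + 1 + 4 * q) = s * m + s * (1 + 4 * q))%R; last by ring.
  by rewrite EFinD addeA leeD2r.
apply/lee_addgt0Pr => e e0.
have L0 : (0 < m + 1 + 4 * q)%R by lra.
pose s := Num.min 2^-1%R (e / (m + 1 + 4 * q))%R.
have s02 : (0 < s <= 2^-1)%R.
  by rewrite lt_min ge_min lexx/= invr_gt0 ltr0n/= andbT divr_gt0.
apply: (le_trans (main _ s02)); rewrite leeD2l// lee_fin -ler_pdivlMr//.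
by rewrite ge_min lexx orbT.
Qed.

(** Fatou's lemma along s = 1/(n+1), applied to u^s E_1(u) S(z - u): these functions converge
    pointwise to E_1(u) S(z - u), and their integrals are at most 1 + s by [powR_tailg_le] and
    [convol_tailg_le]. *)
Lemma convol_tailg0_le1 z : (0 < z)%R -> convol (tailg 0) Smix z <= 1.
Proof.
move=> z0; have [mT T0] := mfge0_tailg (0 : R); have [mS S0] := @mfge0_Smix R.
pose f n u : \bar R := (u `^ n.+1%:R^-1)%:E * tailg 0 u * Smix (z - u)%R.
have mf n : measurable_fun [set: R] (f n).
  apply: emeasurable_funM; last exact: measurable_subl.
  apply: emeasurable_funM; last exact: mT.
  by apply/measurable_EFinP; exact: (measurable_powR n.+1%:R^-1).
have f0 n u : 0 <= f n u by rewrite !mule_ge0// lee_fin powR_ge0.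
have fle n : \int[mu]_u f n u <= (1 + n.+1%:R^-1)%:E.
  apply: (@le_trans _ _ (convol (tailg n.+1%:R^-1) Smix z)); last first.
    by apply: convol_tailg_le => //; rewrite invr_gt0 ltr0n/= invf_le1// ler1n.
  have [mTn Tn0] := mfge0_tailg (n.+1%:R^-1 : R).
  apply: ge0_le_integral => //; first exact: mf.
  - by apply: emeasurable_funM; [exact: mTn|exact: measurable_subl].
  - by move=> u _; apply: lee_wpmul2r => //; apply: powR_tailg_le; rewrite invr_ge0.
have fcvg u : f n u @[n --> \oo] --> tailg 0 u * Smix (z - u)%R.
  have [u0|u0] := leP u 0%R.
    rewrite tailg_le0// mul0e.
    rewrite (_ : f ^~ u = cst 0); first exact: cvg_cst.
    by apply/funext => n; rewrite /f tailg_le0// mule0 mul0e.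
  rewrite (_ : f ^~ u = fun n => (u `^ n.+1%:R^-1)%:E * (tailg 0 u * Smix (z - u)%R)); last first.
    by apply/funext => n; rewrite /f muleA.
  rewrite -[X in _ --> X]mul1e; apply: cvgeM.
  (* The fixed factor is a priori allowed to be infinite; the product of limits is still defined, as
     the other factor tends to 1 and not to 0. *)
  - have [fin|nfin] := boolP (tailg 0 u * Smix (z - u)%R \is a fin_num).
      exact: mule_def_fin.
    by apply: mule_def_neq0_infty => //; rewrite onee_neq0.
  - apply: cvg_EFin; first exact: nearW.
    rewrite -[X in _ --> X]expR0 -(mul0r (ln u)).
    rewrite (_ : _ \o _ = fun n : nat => expR (n.+1%:R^-1 * ln u))%R; last first.
      by apply/funext => n; rewrite /= /powR gt_eqF.
    apply: (@cvg_comp _ _ _ (fun n : nat => n.+1%:R^-1 * ln u)%R expR _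
      (nbhs (0 * ln u)%R)); last exact: continuous_expR.
    by apply: cvgMl; exact: cvg_harmonic.
  - exact: cvg_cst.
have := @fatou _ _ R mu setT measurableT f mf (fun n u _ => f0 n u).
under eq_integral do rewrite (cvg_limn_einf_sup (fcvg _)).1.
move/le_trans; apply.
have c1 : (1 + (n.+1%:R^-1 : R))%:E @[n --> \oo] --> (1 : \bar R).
  apply: cvg_EFin; first exact: nearW.
  rewrite -[X in _ --> X](addr0 1%R); apply: cvgD; first exact: cvg_cst.
  exact: cvg_harmonic.
rewrite -(cvg_limn_einf_sup c1).1 !limn_einf_lim.
apply: lee_lim; [exact: is_cvg_einfs|exact: is_cvg_einfs|].
apply: nearW => n; apply: le_ereal_inf_tmp => _ [m /= nm <-].
by apply: le_trans (fle m); apply: ereal_inf_lbound; exists m.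
Qed.

(** [Gamma_fun_lb] makes t^(r-1) / Gamma(r) at most 2^(-r) / c, integrable in r. Finiteness is what
    allows the real-valued [calS] to be identified with [Smix], no information being lost through
    [fine]. *)
Lemma Smix_lty t : (0 < t)%R -> Smix t < +oo.
Proof.
move=> t0; pose c := (t * expR (- (4 * t)) / 2)%R.
have c0 : (0 < c)%R by rewrite !mulr_gt0 ?expR_gt0.
have [mh h0] := @mfge0_heav R.
have ln20 : (0 < ln 2 :> R)%R by rewrite ln_gt0// ltr1n.
apply: (@le_lt_trans _ _ (\int[mu]_r ((c^-1)%:E *
    (if (0 < r)%R then expR (- ln 2 * r) else 0%R)%:E))).
  apply: ge0_le_integral => //.
  - by move=> r _; rewrite mule_ge0 ?gdens_ge0.
  - by apply: emeasurable_funM => //; exact: measurable_gdens_comp.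
  - by apply: emeasurable_funM => //; exact: measurable_posexpE.
  - move=> r _; have [r0|r0] := ltP 0%R r; last by rewrite heav_le0// mul0e mule0.
    rewrite heav_gt0// mul1e /gdens -EFinM lee_fin ler_pdivrMr ?Gamma_fun_gt0//.
    have := Gamma_fun_lb _ _ r0 t0; rewrite -/c => H.
    apply: (@le_trans _ _ (t `^ (r - 1))%R).
      by rewrite gkerE// ler_piMr ?powR_ge0// expR_le1 oppr_le0 ltW.
    rewrite (_ : t `^ (r - 1) =
      c^-1 * expR (- ln 2 * r) * (t `^ (r - 1) * 2 `^ r * c))%R; last first.
      rewrite [in RHS](_ : 2 `^ r = expR (ln 2 * r))%R; last first.
        by rewrite /powR pnatr_eq0/= mulrC.
      by rewrite mulNr expRN; field; rewrite !gt_eqF ?expR_gt0.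
    by rewrite ler_wpM2l// mulr_ge0 ?expR_ge0// invr_ge0 ltW.
rewrite ge0_integralZl//; last 3 first.
- exact: measurable_posexpE.
- by move=> r _; exact: posexp_ge0.
- by rewrite lee_fin invr_ge0 ltW.
apply: (@le_lt_trans _ _ ((c^-1)%:E * (ln 2)^-1%:E)); last by rewrite -EFinM ltry.
by rewrite lee_wpmul2l ?lee_fin ?invr_ge0 ?(ltW c0)// integral_posexp_le.
Qed.

End sonine.

(** * Volterra operators *)

Section kernels.
Context {R : realType}.
Local Notation mu := (@lebesgue_measure R).
Implicit Types (x z t u b c alpha : R) (k : R -> R) (phi : R -> R).
Local Open Scope ereal_scope.

(* No integrability is needed: both sides are [-oo] when the integral is
   [+oo - +oo] and [c > 0], and [0] when [c = 0]. *)
Lemma integralZl_ge0 c (g : R -> \bar R) : (0 <= c)%R ->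
  measurable_fun setT g -> \int[mu]_x (c%:E * g x) = c%:E * \int[mu]_x g x.
Proof.
move=> c0 mg; rewrite integralE [in RHS]integralE.
have -> : (fun x => c%:E * g x)^\+ = (fun x => c%:E * g^\+ x).
  exact: ge0_funeposM.
have -> : (fun x => c%:E * g x)^\- = (fun x => c%:E * g^\- x).
  exact: ge0_funenegM.
rewrite !ge0_integralZl_EFin//; last 2 first.
- exact: measurable_funeneg.
- exact: measurable_funepos.
have A0 : 0 <= \int[mu]_x g^\+ x by exact: integral_ge0.
have B0 : 0 <= \int[mu]_x g^\- x by exact: integral_ge0.
move: (\int[mu]_x g^\+ x) (\int[mu]_x g^\- x) A0 B0 => A B A0 B0.
move: c0; rewrite le_eqVlt => /predU1P[<-|c0]; first by rewrite !mul0e sube0.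
case: A A0 => [p||]// _; case: B B0 => [q||]// _;
  by rewrite ?gt0_muley ?lte_fin//= ?gt0_muleNy ?lte_fin// -!EFinM -!EFinB mulrBr.
Qed.

(* The value [k0 0], possibly junk, only matters at the negligible endpoint
   [t = x]. *)
Lemma integral_itv_kernel k (k0 : R -> R) (G : R -> \bar R) x b :
  measurable_fun setT k -> (forall u, (u <= 0)%R -> k u = 0%R) ->
  (forall u, (0 < u)%R -> k u = k0 u) ->
  measurable_fun setT G -> (forall t, (b < t)%R -> G t = 0) ->
  \int[mu]_(t in `[x, b]) ((k0 (t - x))%:E * G t) =
  \int[mu]_t ((k (t - x))%:E * G t).
Proof.
move=> mk k_le0 kk0 mG Gb.
have mkG : measurable_fun [set: R] (fun t => (k (t - x))%:E * G t).
  apply: emeasurable_funM => //; apply/measurable_EFinP.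
  by apply: (measurableT_comp mk); exact: measurable_funB.
have E t : t \in `]x, b]%classic -> (k0 (t - x))%:E * G t = (k (t - x))%:E * G t.
  by rewrite inE/= in_itv/= => /andP[xt _]; rewrite kk0// subr_gt0.
rewrite -integral_itv_obnd_cbnd; last first.
  by apply: eq_measurable_fun (measurable_funTS mkG) => t /E.
transitivity (\int[mu]_(t in `]x, b]) ((k (t - x))%:E * G t)).
  exact: eq_integral.
rewrite integral_mkcond.
apply: eq_integral => t _; rewrite patchE mem_setE in_itv/=.
case: ifPn => //; rewrite negb_and -!leNgt -ltNge => /orP[tx|bt].
  by rewrite k_le0 ?mul0e// subr_le0.
by rewrite Gb// mule0.
Qed.

(** Kept abstract in the two kernels because both orders of composition are instances. Integrating
    first in the intermediate variable t produces the convolution of the kernels at y - x. *)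
Lemma fubini_kernels (k1 k2 phi : R -> R) x :
  measurable_fun setT k1 -> measurable_fun setT k2 ->
  (forall u, 0 <= k1 u)%R -> (forall u, 0 <= k2 u)%R ->
  (forall u, (u <= 0)%R -> k1 u = 0%R) -> (forall u, (u <= 0)%R -> k2 u = 0%R) ->
  (forall z, (0 < z)%R -> convol (EFin \o k1) (EFin \o k2) z = 1) ->
  mu.-integrable setT (EFin \o phi) ->
  \int[mu]_t ((k1 (t - x))%:E * \int[mu]_y ((k2 (y - t))%:E * (phi y)%:E)) =
  \int[mu]_y (heav (y - x) * (phi y)%:E).
Proof.
move=> mk1 mk2 k10 k20 k1_le0 k2_le0 k12 iphi.
have mphi : measurable_fun setT phi by apply/measurable_EFinP; exact: measurable_int iphi.
have [mh h0] := @mfge0_heav R.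
have inner y : \int[mu]_t ((k1 (t - x)) * (k2 (y - t)))%:E = heav (y - x).
  transitivity (convol (EFin \o k1) (EFin \o k2) (y - x)).
    rewrite -(ge0_integral_shift x).
    - apply: eq_integral => t _; rewrite addrK EFinM /=.
      by congr (_ * (k2 _)%:E); ring.
    - apply/measurable_EFinP; apply: measurable_funM.
        by apply: (measurableT_comp mk1); exact: measurable_funB.
      by apply: (measurableT_comp mk2); exact: measurable_funB.
    - by move=> t; rewrite lee_fin mulr_ge0.
  have [z0|z0] := leP (y - x)%R 0%R; last by rewrite k12// heav_gt0.
  rewrite heav_le0//; apply: integral0_eq => u _ /=.
  have [u0|u0] := leP u 0%R; first by rewrite k1_le0// mul0e.
  by rewrite k2_le0 ?mule0//; lra.
pose h (w : R * R) : \bar R := (phi w.2 * (k1 (w.1 - x) * k2 (w.2 - w.1)))%:E.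
have mh2 : measurable_fun setT h.
  apply/measurable_EFinP; apply: measurable_funM.
    by apply: (measurableT_comp mphi).
  apply: measurable_funM.
    by apply: (measurableT_comp mk1); exact: measurable_funB.
  by apply: (measurableT_comp mk2); exact: measurable_funB.
have mkk y : measurable_fun setT (fun t => (k1 (t - x) * k2 (y - t))%:E).
  apply/measurable_EFinP; apply: measurable_funM.
    by apply: (measurableT_comp mk1); exact: measurable_funB.
  by apply: (measurableT_comp mk2); exact: measurable_funB.
have ih : (mu \x mu).-integrable setT h.
  apply/integrable21ltyP => //.
  apply: (@le_lt_trans _ _ (\int[mu]_y `|(phi y)%:E|)); last first.
    by case/integrableP : iphi.
  have E y : \int[mu]_t `|h (t, y)| = `|(phi y)%:E| * heav (y - x).
    rewrite -inner -ge0_integralZl//; last 2 first.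
    - exact: mkk.
    - by move=> t _; rewrite lee_fin mulr_ge0.
    apply: eq_integral => t _; rewrite /h/= -EFinM normrM; congr (_ * _)%:E.
    by rewrite ger0_norm// mulr_ge0.
  under eq_integral do rewrite E.
  apply: ge0_le_integral => //.
  - by move=> y _; rewrite mule_ge0.
  - apply: emeasurable_funM.
      by apply/measurable_EFinP; exact: measurableT_comp.
    by apply: (measurableT_comp mh); exact: measurable_funB.
  - by apply/measurable_EFinP; exact: measurableT_comp.
  - move=> y _; rewrite -[leRHS]mule1 lee_wpmul2l//.
    by rewrite /heav lee_fin; case: (_ < _)%R.
transitivity (\int[mu]_t \int[mu]_y h (t, y)).
  (* For individual t the integral in y may fail to converge absolutely, so the factor is moved
     inside by [integralZl_ge0], which holds regardless. *)
  apply: eq_integral => t _; rewrite -integralZl_ge0//.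
  - by apply: eq_integral => y _; rewrite -!EFinM /h/=; congr EFin; ring.
  - apply: emeasurable_funM; apply/measurable_EFinP => //.
    by apply: (measurableT_comp mk2); exact: measurable_funB.
rewrite (Fubini ih); apply: eq_integral => y _.
rewrite -inner muleC -integralZl//.
apply/integrableP; split; first exact: mkk.
under eq_integral => t _ do rewrite gee0_abs ?lee_fin ?mulr_ge0//.
by rewrite inner ltry.
Qed.

Lemma expint1E x : (0 < x)%R -> expint1 x = fine (tailg 0 x).
Proof.
move=> x0; rewrite /expint1 /Rintegral /tailg integral_mkcond; congr fine.
apply: eq_integral => u _; rewrite patchE mem_setE in_itv/= andbT x0/=.
have [xu|xu] := leP x u; last by rewrite mul0r.
have u0 := lt_le_trans x0 xu.
by rewrite mul1r gkerE// powRB1// powRr0 mul1r mulrC.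
Qed.

Lemma Smix_ge0 t : 0 <= Smix t.
Proof. exact: mfge0_Smix.2. Qed.

Lemma Smix_le0 t : (t <= 0)%R -> Smix t = 0.
Proof.
by move=> t0; apply: integral0_eq => s _; rewrite /gdens gker_le0// mul0r mule0.
Qed.

Lemma Smix_fin t : Smix t \is a fin_num.
Proof.
have [t0|t0] := leP t 0%R; first by rewrite Smix_le0.
by rewrite ge0_fin_numE ?Smix_ge0// Smix_lty.
Qed.

Lemma calSE t : (0 < t)%R -> calS t = fine (Smix t).
Proof.
move=> t0; rewrite /calS /Rintegral.
set I := (X in fine X); have -> : I = (expR t)%:E * Smix t.
  rewrite /I integral_mkcond -integralZl_ge0 ?expR_ge0//.
    apply: eq_integral => s _; rewrite patchE mem_setE in_itv/= andbT.
    have [s0|s0] := ltP 0%R s; last by rewrite heav_le0// mul0e mule0.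
    rewrite heav_gt0// mul1e /gdens gkerE// -EFinM; congr EFin.
    rewrite expRN; move: ((Gamma_fun s)^-1)%R => g.
    by field; rewrite gt_eqF ?expR_gt0.
  exact: (measurableT_comp measurable_Smix_integrand (pair1_measurable t)).
by rewrite fineM ?Smix_fin//= mulrA -expRD addNr expR0 mul1r.
Qed.

(** The prefactor 1/alpha of the operator is absorbed here; it is the Jacobian that makes the
    convolution with [kerS alpha] independent of alpha. Both kernels vanish on u <= 0, which encodes
    the lower limit of integration. *)
Definition kerJ alpha u : R := (fine (tailg 0 (u / alpha)) / alpha)%R.

Definition kerS alpha u : R := fine (Smix (u / alpha)).

Lemma tailg0_fin x : tailg 0 x \is a fin_num.
Proof. by rewrite ge0_fin_numE ?tailg_ge0// tailg0_lty. Qed.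

Lemma kerJ_ge0 alpha u : (0 < alpha)%R -> (0 <= kerJ alpha u)%R.
Proof. by move=> a0; rewrite divr_ge0 ?(ltW a0)// fine_ge0// tailg_ge0. Qed.

Lemma kerS_ge0 alpha u : (0 <= kerS alpha u)%R.
Proof. by rewrite fine_ge0// Smix_ge0. Qed.

Lemma kerJ_le0 alpha u : (0 < alpha)%R -> (u <= 0)%R -> kerJ alpha u = 0%R.
Proof.
by move=> a0 u0; rewrite /kerJ tailg_le0 ?mul0r// pmulr_lle0// invr_gt0.
Qed.

Lemma kerS_le0 alpha u : (0 < alpha)%R -> (u <= 0)%R -> kerS alpha u = 0%R.
Proof. by move=> a0 u0; rewrite /kerS Smix_le0// pmulr_lle0// invr_gt0. Qed.

Lemma measurable_kerJ alpha : measurable_fun [set: R] (kerJ alpha).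
Proof.
apply: measurable_funM => //; apply: measurableT_comp => //.
by apply: (measurableT_comp (mfge0_tailg 0).1); exact: measurable_funM.
Qed.

Lemma measurable_kerS alpha : measurable_fun [set: R] (kerS alpha).
Proof.
apply: measurableT_comp => //.
by apply: (measurableT_comp mfge0_Smix.1); exact: measurable_funM.
Qed.

Lemma mfge0_kerJ alpha : (0 < alpha)%R -> mfge0 (EFin \o kerJ alpha).
Proof.
move=> a0; split=> [|u]; last by rewrite lee_fin kerJ_ge0.
by apply/measurable_EFinP; exact: measurable_kerJ.
Qed.

Lemma mfge0_kerS alpha : mfge0 (EFin \o kerS alpha).
Proof.
split=> [|u]; last by rewrite lee_fin kerS_ge0.
by apply/measurable_EFinP; exact: measurable_kerS.
Qed.

(** The substitution of alpha u for u reduces to the unscaled Sonine pair at z / alpha, where the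
    two one-sided estimates combine to equality. *)
Lemma convol_kerJS alpha z : (0 < alpha)%R -> (0 < z)%R ->
  convol (EFin \o kerJ alpha) (EFin \o kerS alpha) z = 1.
Proof.
move=> a0 z0; have za : (0 < z / alpha)%R by rewrite divr_gt0.
transitivity (convol (tailg 0) Smix (z / alpha)); last first.
  by apply/eqP; rewrite eq_le convol_tailg0_le1// convol_tailg0_ge1.
have [mJ J0] := mfge0_kerJ _ a0; have [mS S0] := mfge0_kerS alpha.
have mJS : measurable_fun [set: R]
    (fun u => (EFin \o kerJ alpha) u * (EFin \o kerS alpha) (z - u)%R).
  by apply: emeasurable_funM; [exact: mJ|exact: measurable_subl mS].
have [mT T0] := @mfge0_tailg R 0%R; have [mM M0] := @mfge0_Smix R.
rewrite /convol (ge0_integral_affine alpha 0 _ a0 mJS); last first.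
  by move=> u; rewrite mule_ge0.
have mA : measurable_fun [set: R] (fun u => (alpha * u + 0)%R).
  by apply: measurable_funD => //; exact: measurable_funM.
refine (etrans (esym (integralZl_ge0 _ _ (ltW a0) (measurableT_comp mJS mA))) _).
apply: eq_integral => u _; rewrite /= /kerJ /kerS addr0.
rewrite (_ : alpha * u / alpha = u)%R; last by field; rewrite gt_eqF.
rewrite (_ : (z - alpha * u) / alpha = z / alpha - u)%R; last by field; rewrite gt_eqF.
rewrite -[in RHS](fineK (tailg0_fin u)) -[in RHS](fineK (Smix_fin _)).
by rewrite -!EFinM; congr EFin; field; rewrite gt_eqF.
Qed.

Lemma fracJE alpha b (G : R -> \bar R) x : (0 < alpha)%R ->
  measurable_fun setT G -> (forall t, (b < t)%R -> G t = 0) ->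
  fracJ alpha b G x = \int[mu]_t ((kerJ alpha (t - x))%:E * G t).
Proof.
move=> a0 mG Gb.
pose k u := (alpha * kerJ alpha u)%R.
rewrite /fracJ (@integral_itv_kernel k (fun u => expint1 (u / alpha)))//.
- rewrite -integralZl_ge0 ?invr_ge0 ?(ltW a0)//.
    apply: eq_integral => t _; rewrite muleA -EFinM; congr (_%:E * _).
    by rewrite /k mulrA mulVf ?mul1r// gt_eqF.
  apply: emeasurable_funM => //; apply/measurable_EFinP.
  apply: measurable_funM => //.
  by apply: (measurableT_comp (measurable_kerJ alpha)); exact: measurable_funB.
- by apply: measurable_funM => //; exact: measurable_kerJ.
- by move=> u u0; rewrite /k kerJ_le0// mulr0.
- move=> u u0; rewrite expint1E ?divr_gt0// /k /kerJ mulrC divfK//.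
  by rewrite gt_eqF.
Qed.

Lemma fracSE alpha b (G : R -> \bar R) x : (0 < alpha)%R ->
  measurable_fun setT G -> (forall t, (b < t)%R -> G t = 0) ->
  fracS alpha b G x = \int[mu]_t ((kerS alpha (t - x))%:E * G t).
Proof.
move=> a0 mG Gb.
rewrite /fracS (@integral_itv_kernel (kerS alpha) (fun u => calS (u / alpha)))//.
- exact: measurable_kerS.
- by move=> u u0; rewrite kerS_le0.
- by move=> u u0; rewrite calSE// divr_gt0.
Qed.

Lemma eq_fracJ alpha b (F G : R -> \bar R) x :
  (forall t, (x <= t <= b)%R -> F t = G t) ->
  fracJ alpha b F x = fracJ alpha b G x.
Proof.
move=> FG; congr (_ * _); apply: eq_integral => t.
by rewrite inE/= in_itv/= => /FG ->.
Qed.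

Lemma eq_fracS alpha b (F G : R -> \bar R) x :
  (forall t, (x <= t <= b)%R -> F t = G t) ->
  fracS alpha b F x = fracS alpha b G x.
Proof.
by move=> FG; apply: eq_integral => t; rewrite inE/= in_itv/= => /FG ->.
Qed.

Lemma measurable_kernel_op k phi : measurable_fun setT k ->
  measurable_fun setT phi ->
  measurable_fun [set: R] (fun t => \int[mu]_y ((k (y - t))%:E * (phi y)%:E)).
Proof.
move=> mk mphi.
apply: (measurable_integral2 (fun w : R * R => (k (w.2 - w.1))%:E * (phi w.2)%:E)).
apply: emeasurable_funM; apply/measurable_EFinP.
  by apply: (measurableT_comp mk); exact: measurable_funB.
exact: (measurableT_comp mphi).
Qed.

Lemma kernel_op_eq0 k phi b t : (forall u, (u <= 0)%R -> k u = 0%R) ->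
  (forall y, (b < y)%R -> phi y = 0%R) -> (b < t)%R ->
  \int[mu]_y ((k (y - t))%:E * (phi y)%:E) = 0.
Proof.
move=> k0 phib bt; apply: integral0_eq => y _.
have [yb|yb] := leP y b; last by rewrite phib// mule0.
by rewrite k0 ?mul0e//; lra.
Qed.

End kernels.

(** * Composition of the two fractional integrals *)

Theorem theorem3p5 (R : realType) (alpha a b : R) (f : R -> R) :
  0 < alpha -> a < b ->
  (@lebesgue_measure R).-integrable `[a, b] (EFin \o f) ->
  {ae @lebesgue_measure R, forall x, x \in `[a, b] ->
    fracJ alpha b (fracS alpha b (EFin \o f)) x
      = fracS alpha b (fracJ alpha b (EFin \o f)) x /\
    fracS alpha b (fracJ alpha b (EFin \o f)) x
      = (\int[@lebesgue_measure R]_(y in `[x, b]) (f y)%:E)%E}.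
Proof.
move=> a0 ab fi; apply: aeW => x.
rewrite in_itv/= => /andP[ax xb].
(* Extension by zero: the operators then become integrals over the whole line, with the limits x and
   b encoded by the vanishing of the kernel and of [phi]. *)
pose phi := (f \_ `[a, b]) : R -> R.
have iphi : (@lebesgue_measure R).-integrable setT (EFin \o phi).
  rewrite /phi -restrict_EFin.
  have mab : measurable `[a, b]%classic by exact: measurable_itv.
  exact: (integrable_mkcond (mu := @lebesgue_measure R) (EFin \o f) mab).1 fi.
have mphi : measurable_fun setT phi.
  by apply/measurable_EFinP; exact: measurable_int iphi.
have phib y : b < y -> phi y = 0.
  by move=> yb; rewrite /phi patchE mem_setE in_itv/= (ltNge b) in yb *;
    rewrite (negbTE yb) andbF.
have fphi y : a <= y <= b -> f y = phi y.
  by move=> y_ab; rewrite /phi patchE mem_setE in_itv/= y_ab.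
pose PS t := (\int[@lebesgue_measure R]_y ((kerS alpha (y - t))%:E * (phi y)%:E))%E.
pose PJ t := (\int[@lebesgue_measure R]_y ((kerJ alpha (y - t))%:E * (phi y)%:E))%E.
have mphiE : measurable_fun setT (EFin \o phi) by exact/measurable_EFinP.
have phibE y : b < y -> (EFin \o phi) y = 0%E by move=> /phib /= ->.
have fS t : x <= t <= b -> fracS alpha b (EFin \o f) t = PS t.
  move=> /andP[xt tb].
  apply: etrans (fracSE _ _ _ t a0 mphiE phibE).
  apply: eq_fracS => y /andP[ty yb] /=.
  by rewrite fphi// yb (le_trans ax)// (le_trans xt).
have fJ t : x <= t <= b -> fracJ alpha b (EFin \o f) t = PJ t.
  move=> /andP[xt tb].
  apply: etrans (fracJE _ _ _ t a0 mphiE phibE).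
  apply: eq_fracJ => y /andP[ty yb] /=.
  by rewrite fphi// yb (le_trans ax)// (le_trans xt).
have mS := measurable_kernel_op _ _ (measurable_kerS alpha) mphi.
have mJ := measurable_kernel_op _ _ (measurable_kerJ alpha) mphi.
(* The inner fractional integrals must vanish beyond b as [phi] does, so that the outer operator can
   also be written over the whole line. *)
have PSb t : b < t -> PS t = 0%E.
  by move=> bt; apply: (kernel_op_eq0 _ _ _ _ _ phib bt) => u; exact: kerS_le0.
have PJb t : b < t -> PJ t = 0%E.
  by move=> bt; apply: (kernel_op_eq0 _ _ _ _ _ phib bt) => u; exact: kerJ_le0.
have rhs : (\int[@lebesgue_measure R]_(y in `[x, b]) (f y)%:E =
    \int[@lebesgue_measure R]_y (heav (y - x) * (phi y)%:E))%E.
  (* The plain integral from x to b is itself an operator of this type, with kernel 1 on ]0, +oo[,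
     so the same lemma rewrites it. *)
  pose h (u : R) : R := (0 < u)%R%:R.
  have mh : measurable_fun setT h.
    by apply: measurable_natr_bool; exact: measurable_fun_ltr.
  rewrite -(@integral_itv_kernel R h (cst 1) (EFin \o phi) x b mh _ _ mphiE phibE).
  - apply: eq_integral => y; rewrite inE/= in_itv/= => /andP[xy yb].
    by rewrite mul1e fphi// yb (le_trans ax).
  - by move=> u u0; rewrite /h ltNge u0.
  - by move=> u u0; rewrite /h u0.
rewrite rhs (eq_fracJ alpha _ _ _ _ fS) (eq_fracS alpha _ _ _ _ fJ).
rewrite (fracJE _ _ _ x a0 mS PSb) (fracSE _ _ _ x a0 mJ PJb).
have kJ0 u := kerJ_ge0 alpha u a0; have kS0 u := kerS_ge0 alpha u.
have kJ0' u := @kerJ_le0 R alpha u a0; have kS0' u := @kerS_le0 R alpha u a0.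
have kJS z := @convol_kerJS R alpha z a0.
have kSJ z : 0 < z ->
    convol (EFin \o kerS alpha) (EFin \o kerJ alpha) z = 1%E.
  by move=> z0; rewrite convolC ?kJS//; [exact: mfge0_kerS|exact: mfge0_kerJ].
have EJS := fubini_kernels _ _ _ x (measurable_kerJ alpha) (measurable_kerS alpha)
  kJ0 kS0 kJ0' kS0' kJS iphi.
have ESJ := fubini_kernels _ _ _ x (measurable_kerS alpha) (measurable_kerJ alpha)
  kS0 kJ0 kS0' kJ0' kSJ iphi.
split; last exact: ESJ.
exact: etrans EJS (esym ESJ).
Qed.
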